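(* Let $\phi$ be a parabolic holomorphic self-map of $\mathbb D$ of zero hyperbolic step. Then there do not exist a non-constant Bloch function $f$ and a unimodular number $\tau$ satisfying $f\circ\phi=\tau f$.
   Context: $\mathbb D$ is the open unit disk, $\mathbb T$ its boundary. For $n\in\mathbb N_0$, $\phi^{[n]}$ denotes the $n$-th iterate of $\phi$. The pseudo-hyperbolic distance is $\rho(z_1,z_2)=\left|\frac{z_2-z_1}{1-\overline{z_2}z_1}\right|$. A holomorphic self-map $\phi$ of $\mathbb D$ is of zero hyperbolic step if $\lim_{n\to\infty}\rho(\phi^{[n]}(z_0),\phi^{[n+1]}(z_0))=0$ for some (equivalently every) $z_0\in\mathbb D$. It is parabolic if its Denjoy--Wolff point lies on $\mathbb T$ and its angular derivative there equals $1$. A Bloch function is a holomorphic $f$ on $\mathbb D$ with $\sup_{z\in\mathbb D}(1-|z|^2)|f'(z)|<\infty$. *)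

(* Defs.v *)
From HB Require Import structures.
From mathcomp Require Import all_boot all_order all_algebra.
From mathcomp Require Import all_classical all_reals all_analysis.
From mathcomp Require Import complex.
Set Implicit Arguments.
Unset Strict Implicit.
Set Warnings "-redundant-canonical-projection -notation-overridden -ambiguous-paths".
Import Order.TTheory GRing.Theory Num.Theory.
Import numFieldNormedType.Exports.
Local Open Scope ring_scope.
Local Open Scope complex_scope.
Local Open Scope classical_set_scope.

(* Equip C = R[i] with its canonical structure of normed module over itself
   (norm = complex modulus), hence its usual (Euclidean) topology.
   With this, [derivable f z 1] is exactly complex differentiability at z:
   the difference quotient (f (z + h) - f z) / h converges as h -> 0, h in C. *)
HB.instance Definition _ (R : rcfType) := GRing.ComAlgebra.copy R[i] R[i]^o.
HB.instance Definition _ (R : rcfType) := Vector.copy R[i] R[i]^o.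
HB.instance Definition _ (R : rcfType) := NormedModule.copy R[i] R[i]^o.

Section Defs.
Variable R : realType.
Local Notation C := R[i].

Definition in_disk (z : C) : Prop := `|z| < 1.

Definition holomorphic_on_disk (f : C -> C) : Prop :=
  forall z, in_disk z -> derivable f z 1.

Definition holomorphic_self_map (phi : C -> C) : Prop :=
  holomorphic_on_disk phi /\ (forall z, in_disk z -> in_disk (phi z)).

Definition pseudo_hyp (z1 z2 : C) : C := `|(z2 - z1) / (1 - z2^* * z1)|.

Definition zero_hyperbolic_step (phi : C -> C) : Prop :=
  exists z0, in_disk z0 /\
    (fun n : nat => pseudo_hyp (iter n phi z0) (iter n.+1 phi z0)) @ \oo
      --> (0 : C).

Definition denjoy_wolff_point (phi : C -> C) (omega : C) : Prop :=
  forall z, in_disk z -> (fun n : nat => iter n phi z) @ \oo --> omega.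

Definition stolz_angle (omega : C) (M : R) : set C :=
  [set z | in_disk z /\ `|omega - z| < M%:C * (1 - `|z|)].

Definition nontangential_limit (g : C -> C) (omega L : C) : Prop :=
  forall M : R, 1 < M -> g @ within (stolz_angle omega M) (nbhs omega) --> L.

Definition angular_derivative_at (phi : C -> C) (omega L : C) : Prop :=
  nontangential_limit (fun z => (phi z - omega) / (z - omega)) omega L.

Definition parabolic (phi : C -> C) : Prop :=
  exists omega : C, `|omega| = 1 /\ denjoy_wolff_point phi omega /\
    angular_derivative_at phi omega 1.

Definition bloch (f : C -> C) : Prop :=
  holomorphic_on_disk f /\
  exists M : R, forall z, in_disk z -> (1 - `|z| ^+ 2) * `|'D_1 f z| <= M%:C.

Definition nonconstant_on_disk (f : C -> C) : Prop :=
  exists z w, in_disk z /\ in_disk w /\ f z <> f w.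

End Defs.

(* Main.v *)
Require Import Defs.
From HB Require Import structures.
From mathcomp Require Import all_boot all_order all_algebra.
From mathcomp Require Import all_classical all_reals all_analysis.
From mathcomp Require Import complex ring lra.
Import Order.TTheory GRing.Theory Num.Theory.
Import numFieldNormedType.Exports.
Local Open Scope ring_scope.
Local Open Scope complex_scope.

(** Let z_k be the orbit of z_0, M_k the disk automorphism with M_k(0) = z_k, and
    w_k = M_k^-1(z_(k+1)), so that |w_k| is the k-th hyperbolic step.  A Bloch
    function is Lipschitz for the hyperbolic metric, hence
    |tau - 1| |f(z_0)| = |f(z_(k+1)) - f(z_k)| tends to 0, and after subtracting
    the constant f(z_0) we may assume f(z_k) = 0 for all k.  Put F_k = f o M_k and
    let m be the largest integer with F_k = O(w^m) at 0 for every k.  The F_k are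
    uniformly bounded on |w| < 1/2 and have the additional zero w_k <> 0, so
    |F_k(w)| <= C |w|^m |w - w_k| with C independent of k.  On the other hand,
    Schwarz-Pick for phi shows that F_k takes near 0 all values which F_K, K <= k,
    takes there, up to unimodular factors, and for some K the function F_K exceeds
    any multiple of |w|^(m+1) near 0.  This is contradictory since w_k tends to 0.

    Maximum principles replace Taylor expansions: the mean value property follows
    from Goursat's lemma applied to H o exp, and removable singularities are
    avoided by applying the maximum principle to q^n P^2 for a quotient q with
    poles at the zeros of P. *)

Set Implicit Arguments.
Unset Strict Implicit.
Unset Printing Implicit Defensive.

(** * The real-valued modulus and complex differentiability *)

Section ComplexModulus.
Variable R : realType.
Local Notation C := R[i].
Local Notation Re := (@complex.Re R).
Local Notation Im := (@complex.Im R).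
Implicit Types (z w : C) (x y : R).

(** [|z|] takes its values in [R[i]]; a real-valued modulus keeps all estimates in the ordered field
    [R]. *)
Definition cabs z : R := Normc.normc z.
Arguments cabs : simpl never.

Lemma normc_cabs z : `|z| = (cabs z)%:C. Proof. by []. Qed.

Lemma cabs_ge0 z : 0 <= cabs z.
Proof. by case: z => a b; rewrite /cabs /= sqrtr_ge0. Qed.
Hint Resolve cabs_ge0 : core.

Lemma cabs0 : cabs 0 = 0. Proof. exact: Normc.normc0. Qed.
Lemma cabs1 : cabs 1 = 1. Proof. exact: Normc.normc1. Qed.
Lemma cabsM z w : cabs (z * w) = cabs z * cabs w. Proof. exact: Normc.normcM. Qed.
Lemma cabsV z : cabs z^-1 = (cabs z)^-1. Proof. exact: Normc.normcV. Qed.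
Lemma cabsN z : cabs (- z) = cabs z. Proof. exact: normcN. Qed.
Lemma cabsC z w : cabs (z - w) = cabs (w - z). Proof. by rewrite -cabsN opprB. Qed.
Lemma cabsD z w : cabs (z + w) <= cabs z + cabs w. Proof. exact: le_normcD. Qed.
Lemma cabsB z w : cabs (z - w) <= cabs z + cabs w.
Proof. by rewrite -(cabsN w) cabsD. Qed.
Lemma cabs_tri w z u : cabs (z - u) <= cabs (z - w) + cabs (w - u).
Proof. rewrite (_ : z - u = (z - w) + (w - u)); [exact: cabsD|ring]. Qed.
Lemma cabs_sub z w : cabs z - cabs w <= cabs (z - w).
Proof. by have := cabsD (z - w) w; rewrite subrK; lra. Qed.
Lemma cabsX z n : cabs (z ^+ n) = cabs z ^+ n.
Proof. by elim: n => [|n IH]; rewrite ?expr0 ?cabs1// !exprS cabsM IH. Qed.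
Lemma cabs_eq0 z : cabs z = 0 -> z = 0. Proof. exact: Normc.eq0_normc. Qed.
Lemma cabs_gt0 z : z != 0 -> 0 < cabs z.
Proof.
move=> z0; rewrite lt_def cabs_ge0 andbT.
by apply: contra z0 => /eqP/cabs_eq0 ->.
Qed.
Lemma cabs_neq0 z : 0 < cabs z -> z != 0.
Proof. by apply: contraTneq => ->; rewrite cabs0 ltxx. Qed.
Lemma cabs_subr_gt0 z w : z != w -> 0 < cabs (z - w).
Proof. by move=> zw; apply: cabs_gt0; rewrite subr_eq0. Qed.
Lemma cabs_conj z : cabs z^* = cabs z.
Proof. by case: z => a b; rewrite /cabs /= sqrrN. Qed.
Lemma cabs_real x : cabs x%:C = `|x|.
Proof. by rewrite /cabs /= expr0n addr0 sqrtr_sqr. Qed.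
Lemma cabs_im x : cabs (0 +i* x) = `|x|.
Proof. by rewrite /cabs /= expr0n add0r sqrtr_sqr. Qed.
Lemma cabs_sqr z : cabs z ^+ 2 = Re z ^+ 2 + Im z ^+ 2.
Proof. by case: z => a b; rewrite /cabs /= sqr_sqrtr// addr_ge0 ?sqr_ge0. Qed.
Lemma sqr_cabs z : ((cabs z) ^+ 2)%:C = z * z^*.
Proof.
by rewrite cabs_sqr; case: z => a b /=; simpc; rewrite -!expr2 [b * a]mulrC addNr.
Qed.
Lemma Re_le_cabs z : `|Re z| <= cabs z.
Proof.
rewrite -(@ler_pXn2r _ 2)// ?nnegrE// cabs_sqr real_normK ?num_real//.
by rewrite lerDl sqr_ge0.
Qed.
Lemma Im_le_cabs z : `|Im z| <= cabs z.
Proof.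
rewrite -(@ler_pXn2r _ 2)// ?nnegrE// cabs_sqr real_normK ?num_real//.
by rewrite lerDr sqr_ge0.
Qed.
Lemma cabs_le_ReIm z : cabs z <= `|Re z| + `|Im z|.
Proof.
have -> : z = (Re z)%:C + (0 +i* Im z) by case: z => a b; simpc.
apply: le_trans (cabsD _ _) _; rewrite cabs_real cabs_im.
by case: z => a b; simpc.
Qed.

Lemma in_diskE z : in_disk z <-> cabs z < 1.
Proof. by rewrite /in_disk normc_cabs -[1]/(1%:C) ltcR. Qed.

Definition ccont (f : C -> C) z :=
  forall e : R, 0 < e -> exists2 d, 0 < d &
    forall w, cabs (w - z) < d -> cabs (f w - f z) < e.

Lemma ccont_cst c z : ccont (fun=> c) z.
Proof. by move=> e e0; exists 1 => // w _; rewrite subrr cabs0. Qed.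

Lemma ccont_id z : ccont id z.
Proof. by move=> e e0; exists e. Qed.

Lemma ccontD f g z : ccont f z -> ccont g z -> ccont (fun w => f w + g w) z.
Proof.
move=> cf cg e e0; have e20 : 0 < e / 2 by lra.
have [d d0 fd] := cf _ e20; have [d' d'0 gd] := cg _ e20.
exists (Num.min d d'); first by rewrite lt_min d0.
move=> w; rewrite lt_min => /andP[/fd h1 /gd h2].
have -> : f w + g w - (f z + g z) = (f w - f z) + (g w - g z) by ring.
by apply: le_lt_trans (cabsD _ _) _; lra.
Qed.

Lemma ccontM f g z : ccont f z -> ccont g z -> ccont (fun w => f w * g w) z.
Proof.
move=> cf cg e e0.
pose K := 1 + cabs (f z) + cabs (g z).
have K0 : 0 < K by rewrite /K; have := cabs_ge0 (f z); have := cabs_ge0 (g z); lra.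
(* With increments a, b < e' <= 1, the error ab + |f z| b + a |g z| is at most K e' <= e / 2. *)
pose e' := Num.min 1 (e / (2 * K)).
have e'0 : 0 < e' by rewrite lt_min ltr01 divr_gt0//; lra.
have [d d0 fd] := cf _ e'0; have [d' d'0 gd] := cg _ e'0.
exists (Num.min d d'); first by rewrite lt_min d0.
move=> w; rewrite lt_min => /andP[/fd h1 /gd h2].
have -> : f w * g w - f z * g z =
  (f w - f z) * (g w - g z) + f z * (g w - g z) + (f w - f z) * g z by ring.
apply: le_lt_trans (cabsD _ _) _; rewrite cabsM.
apply: le_lt_trans (lerD (cabsD _ _) (lexx _)) _; rewrite !cabsM.
have := cabs_ge0 (f w - f z); have := cabs_ge0 (g w - g z).
have := cabs_ge0 (f z); have := cabs_ge0 (g z).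
move: h1 h2; rewrite /e' !lt_min => /andP[h1 h1'] /andP[h2 h2'].
move: h1' h2'; rewrite !ltr_pdivlMr; try lra.
rewrite /K; set a := cabs (f w - f z); set b := cabs (g w - g z).
move: h1 h2; set p := cabs (f z); set q := cabs (g z); rewrite -/a -/b.
by move=> *; nra.
Qed.

Lemma ccont_comp f g z : ccont f z -> ccont g (f z) -> ccont (fun w => g (f w)) z.
Proof.
move=> cf cg e e0; have [d d0 gd] := cg _ e0.
by have [d' d'0 fd] := cf _ d0; exists d' => // w /fd/gd.
Qed.

Lemma ccontV z : z != 0 -> ccont (fun w => w^-1) z.
Proof.
move=> z0 e e0; have a0 := cabs_gt0 z0.
exists (Num.min (cabs z / 2) (e * cabs z ^+ 2 / 2)).
  by rewrite lt_min; apply/andP; split; [lra|rewrite divr_gt0// mulr_gt0// exprn_gt0].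
move=> w; rewrite lt_min => /andP[h1 h2].
have hw : cabs z / 2 < cabs w by have := cabs_sub z w; rewrite cabsC; lra.
have w0 : w != 0 by apply: cabs_neq0; lra.
have -> : w^-1 - z^-1 = (z - w) / (w * z) by field; rewrite w0 z0.
rewrite cabsM cabsV cabsM cabsC ltr_pdivrMr; last by apply: mulr_gt0; lra.
apply: lt_le_trans h2 _; rewrite -subr_ge0.
rewrite (_ : _ - _ = e * cabs z * (cabs w - cabs z / 2)); last by field.
by rewrite !mulr_ge0 ?ltW//; lra.
Qed.

(* Caratheodory's form of complex differentiability. *)
Definition cderiv (f : C -> C) z l :=
  exists q : C -> C, [/\ ccont q z, q z = l &
    exists2 d, 0 < d & forall w, cabs (w - z) < d -> f w - f z = q w * (w - z)].

Definition cdiff f z := exists l, cderiv f z l.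

Lemma cderiv_cst c z : cderiv (fun=> c) z 0.
Proof. by exists (fun=> 0); split=> //; [exact: ccont_cst|exists 1 => // w _; ring]. Qed.

Lemma cderiv_id z : cderiv id z 1.
Proof. by exists (fun=> 1); split=> //; [exact: ccont_cst|exists 1 => // w _; ring]. Qed.

Lemma cderiv_ccont f z l : cderiv f z l -> ccont f z.
Proof.
case=> q [cq _ [d d0 fd]] e e0.
have : ccont (fun w => q w * (w - z)) z.
  by apply: ccontM => //; apply: ccontD; [exact: ccont_id|exact: ccont_cst].
move=> /(_ _ e0)[d' d'0 h]; exists (Num.min d d'); first by rewrite lt_min d0.
move=> w; rewrite lt_min => /andP[/fd -> /h].
by rewrite subrr mulr0 subr0.
Qed.

Lemma cderivD f g z a b : cderiv f z a -> cderiv g z b ->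
  cderiv (fun w => f w + g w) z (a + b).
Proof.
case=> p [cp <- [d d0 fd]] [q [cq <- [d' d'0 gd]]].
exists (fun w => p w + q w); split=> //; first exact: ccontD.
exists (Num.min d d'); first by rewrite lt_min d0.
move=> w; rewrite lt_min => /andP[/fd h1 /gd h2].
by rewrite mulrDl -h1 -h2; ring.
Qed.

Lemma cderivM f g z a b : cderiv f z a -> cderiv g z b ->
  cderiv (fun w => f w * g w) z (f z * b + a * g z).
Proof.
move=> Df; have := cderiv_ccont Df; move: Df.
case=> p [cp <- [d d0 fd]] cf [q [cq <- [d' d'0 gd]]].
exists (fun w => f w * q w + p w * g z); split=> //.
  by apply: ccontD; apply: ccontM => //; exact: ccont_cst.
exists (Num.min d d'); first by rewrite lt_min d0.
move=> w; rewrite lt_min => /andP[/fd h1 /gd h2].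
have -> : f w * g w - f z * g z = f w * (g w - g z) + (f w - f z) * g z by ring.
by rewrite h1 h2; ring.
Qed.

Lemma cderiv_comp f g z a b : cderiv f z a -> cderiv g (f z) b ->
  cderiv (fun w => g (f w)) z (b * a).
Proof.
move=> Df; have cf := cderiv_ccont Df; move: Df.
case=> p [cp <- [d d0 fd]] [q [cq <- [d' d'0 gd]]].
exists (fun w => q (f w) * p w); split=> //.
  by apply: ccontM => //; exact: ccont_comp.
have [d2 d20 h2] := cf _ d'0; exists (Num.min d d2); first by rewrite lt_min d0.
by move=> w; rewrite lt_min => /andP[/fd h1 /h2/gd ->]; rewrite h1; ring.
Qed.

Lemma cderivV z : z != 0 -> cderiv (fun w => w^-1) z (- z ^- 2).
Proof.
move=> z0; exists (fun w => - z^-1 * w^-1); split.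
- by apply: ccontM; [exact: ccont_cst|exact: ccontV].
- by field.
- exists (cabs z); first exact: cabs_gt0.
  move=> w wz; have w0 : w != 0.
    by apply: contraTneq wz => ->; rewrite sub0r cabsN ltxx.
  by field; rewrite w0 z0.
Qed.

Lemma cderiv_local f g z l d : 0 < d ->
  (forall w, cabs (w - z) < d -> f w = g w) -> cderiv f z l -> cderiv g z l.
Proof.
move=> d0 fg [q [cq qz [d' d'0 h]]]; exists q; split=> //.
exists (Num.min d d'); first by rewrite lt_min d0.
move=> w; rewrite lt_min => /andP[/fg <- /h <-].
by rewrite -fg// subrr cabs0.
Qed.

Lemma cdiff_ccont f z : cdiff f z -> ccont f z.
Proof. by case=> l /cderiv_ccont. Qed.
Lemma cdiff_cst c z : cdiff (fun=> c) z.
Proof. by exists 0; exact: cderiv_cst. Qed.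
Lemma cdiff_id z : cdiff (fun w => w) z.
Proof. by exists 1; exact: cderiv_id. Qed.
Lemma cdiffD f g z : cdiff f z -> cdiff g z -> cdiff (fun w => f w + g w) z.
Proof. by move=> [a ha] [b hb]; exists (a + b); exact: cderivD. Qed.
Lemma cdiffM f g z : cdiff f z -> cdiff g z -> cdiff (fun w => f w * g w) z.
Proof. by move=> [a ha] [b hb]; eexists; exact: cderivM ha hb. Qed.
Lemma cdiffX f z n : cdiff f z -> cdiff (fun w => f w ^+ n) z.
Proof.
move=> df; elim: n => [|n IH]; first exact: cdiff_cst.
have [l h] := cdiffM df IH; exists l; apply: cderiv_local (ltr01) _ h.
by move=> w _; rewrite exprS.
Qed.
Lemma cdiff_comp f g z : cdiff f z -> cdiff g (f z) -> cdiff (fun w => g (f w)) z.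
Proof. by move=> [a ha] [b hb]; eexists; exact: cderiv_comp ha hb. Qed.
Lemma cdiffV f z : f z != 0 -> cdiff f z -> cdiff (fun w => (f w)^-1) z.
Proof. by move=> f0 df; apply: cdiff_comp df _; eexists; exact: cderivV f0. Qed.

Lemma cderiv_epsP f z l : cderiv f z l <->
  forall e : R, 0 < e -> exists2 d, 0 < d & forall w, cabs (w - z) < d ->
    cabs (f w - f z - l * (w - z)) <= e * cabs (w - z).
Proof.
split=> [[q [cq <- [d d0 fd]]] e e0|h].
  have [d' d'0 h] := cq _ e0; exists (Num.min d d'); first by rewrite lt_min d0.
  move=> w; rewrite lt_min => /andP[/fd -> /h hw].
  by rewrite -mulrBl cabsM ler_wpM2r// ltW.
(* The continuous factor is the difference quotient, completed by l at z. *)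
exists (fun w => if w == z then l else (f w - f z) / (w - z)); split=> [e e0||].
- have e20 : 0 < e / 2 by lra.
  have [d d0 fd] := h _ e20; exists d => // w /fd; rewrite eqxx.
  case: eqVneq => [-> _|wz]; first by rewrite subrr cabs0.
  have wz0 := cabs_subr_gt0 wz.
  have -> : f w - f z - l * (w - z) = ((f w - f z) / (w - z) - l) * (w - z).
    by rewrite mulrBl divfK// subr_eq0.
  by rewrite cabsM ler_pM2r//; lra.
- by rewrite eqxx.
- exists 1 => // w _; case: eqVneq => [->|wz]; first by ring.
  by rewrite divfK// subr_eq0.
Qed.

Lemma cderiv_lip f z l : cderiv f z l -> exists2 d, 0 < d &
  forall w, cabs (w - z) < d -> cabs (f w - f z) <= (cabs l + 1) * cabs (w - z).
Proof.
move=> /cderiv_epsP/(_ _ ltr01)[d d0 h]; exists d => // w /h; rewrite mul1r => hw.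
have -> : f w - f z = (f w - f z - l * (w - z)) + l * (w - z) by ring.
by apply: le_trans (cabsD _ _) _; rewrite [cabs (l * _)]cabsM; lra.
Qed.

(** The quadratic bound forces f z = 0 and makes f w / (w - z) tend to 0. This gives
    differentiability at points where a bounded factor is multiplied by the square of a function
    vanishing there. *)
Lemma cderiv_sqr0 f z K d : 0 < d ->
  (forall w, cabs (w - z) < d -> cabs (f w) <= K * cabs (w - z) ^+ 2) ->
  cderiv f z 0.
Proof.
move=> d0 h.
have fz : f z = 0.
  apply: cabs_eq0; apply/eqP; rewrite eq_le cabs_ge0 andbT.
  by have := h z; rewrite subrr cabs0 expr0n mulr0; apply.
apply/cderiv_epsP => e e0; pose K' := 1 + `|K|.
have K'0 : 0 < K' by rewrite /K'; have := normr_ge0 K; lra.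
exists (Num.min d (e / K')); first by rewrite lt_min d0 divr_gt0.
move=> w; rewrite lt_min ltr_pdivlMr// => /andP[/h hw he].
rewrite fz mul0r !subr0; apply: le_trans hw _.
rewrite expr2 mulrA; apply: ler_wpM2r => //.
apply: le_trans (ltW he); rewrite mulrC; apply: ler_wpM2l => //.
by rewrite /K'; have := ler_norm K; lra.
Qed.

End ComplexModulus.
Arguments cabs : simpl never.
#[global] Hint Extern 0 (is_true (_ <= cabs _)) => (exact: cabs_ge0) : core.

(** * Integration of complex-valued functions over a segment *)

Section Integral.
Variable R : realType.
Local Notation C := R[i].
Local Notation Re := (@complex.Re R).
Local Notation Im := (@complex.Im R).
Local Notation mu := (@lebesgue_measure R).
Implicit Types (g h : R -> C) (a b c t : R).

Definition pcont g t := forall e : R, 0 < e -> exists2 d, 0 < d &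
  forall s, `|s - t| < d -> cabs (g s - g t) < e.

(** Continuity is two-sided even at a and b, as holds for restrictions of functions that are complex
    differentiable at each point of the segment. *)
Definition pcont_itv g a b := forall t, a <= t <= b -> pcont g t.

Definition cint g a b : C :=
  (\int[mu]_(t in `[a, b]) Re (g t))%R +i* (\int[mu]_(t in `[a, b]) Im (g t))%R.

Lemma integrable_itv (u : R -> R) a b :
  (forall t, a <= t <= b -> forall e : R, 0 < e -> exists2 d, 0 < d &
     forall s, `|s - t| < d -> `|u s - u t| < e) ->
  mu.-integrable `[a, b] (EFin \o u).
Proof.
move=> cu; apply: continuous_compact_integrable; first exact: segment_compact.
apply: continuous_in_subspaceT => t; rewrite inE /= in_itv /= => tab.
apply/cvgrPdist_lt => e e0; have [d d0 h] := cu t tab e e0.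
by near=> s; rewrite distrC; apply: h; rewrite distrC; near: s; exact: cvgr_dist_lt.
Unshelve. all: by end_near. Qed.

Lemma integrable_Re g a b : pcont_itv g a b ->
  mu.-integrable `[a, b] (EFin \o (fun t => Re (g t))).
Proof.
move=> cg; apply: integrable_itv => t tab e e0.
have [d d0 h] := cg t tab e e0; exists d => // s /h; apply: le_lt_trans.
by rewrite -raddfB Re_le_cabs.
Qed.

Lemma integrable_Im g a b : pcont_itv g a b ->
  mu.-integrable `[a, b] (EFin \o (fun t => Im (g t))).
Proof.
move=> cg; apply: integrable_itv => t tab e e0.
have [d d0 h] := cg t tab e e0; exists d => // s /h; apply: le_lt_trans.
by rewrite -raddfB Im_le_cabs.
Qed.

Lemma Rint_split (u : R -> R) a c b : a <= c <= b ->
  mu.-integrable `[a, b] (EFin \o u) ->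
  (\int[mu]_(t in `[a, b]) u t = \int[mu]_(t in `[a, c]) u t +
    \int[mu]_(t in `[c, b]) u t)%R.
Proof.
move=> /andP[ac cb] iu; apply/eqP; rewrite addrC -subr_eq; apply/eqP.
rewrite (@Rintegral_itvB _ _ (BLeft a) (BRight b) c)//=.
apply: Rintegral_itv_obnd_cbnd.
have := integrableS _ _ _ iu; apply=> //=.
by apply: subset_itvr; rewrite bnd_simp.
Qed.

Lemma cint_split g a c b : a <= c <= b -> pcont_itv g a b ->
  cint g a b = cint g a c + cint g c b.
Proof.
move=> acb cg; rewrite /cint (Rint_split acb (integrable_Re cg)).
by rewrite (Rint_split acb (integrable_Im cg)).
Qed.

Lemma cintB g h a b : pcont_itv g a b -> pcont_itv h a b ->
  cint (fun t => g t - h t) a b = cint g a b - cint h a b.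
Proof.
move=> cg ch; rewrite /cint.
have -> : (\int[mu]_(t in `[a, b]) Re (g t - h t) = \int[mu]_(t in `[a, b]) Re (g t)
   - \int[mu]_(t in `[a, b]) Re (h t))%R.
  rewrite -RintegralB//; [|exact: integrable_Re|exact: integrable_Re].
  by apply: eq_Rintegral => t _; rewrite raddfB.
have -> : (\int[mu]_(t in `[a, b]) Im (g t - h t) = \int[mu]_(t in `[a, b]) Im (g t)
   - \int[mu]_(t in `[a, b]) Im (h t))%R.
  rewrite -RintegralB//; [|exact: integrable_Im|exact: integrable_Im].
  by apply: eq_Rintegral => t _; rewrite raddfB.
by [].
Qed.

Lemma Rint_cst_itv a b r : a <= b -> (\int[mu]_(t in `[a, b]) r = r * (b - a))%R.
Proof.
move=> ab; rewrite Rintegral_cst//= lebesgue_measure_itv/= lte_fin.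
case: ltP => //= ba.
by rewrite (_ : a = b) ?subrr//; apply/eqP; rewrite eq_le ab.
Qed.

Lemma Rint_close (u : R -> R) a b r e : a <= b ->
  mu.-integrable `[a, b] (EFin \o u) ->
  (forall t, a <= t <= b -> `|u t - r| <= e) ->
  `|(\int[mu]_(t in `[a, b]) u t)%R - r * (b - a)| <= e * (b - a).
Proof.
move=> ab iu h.
have ic s : mu.-integrable `[a, b] (EFin \o (fun=> s)).
  by apply: integrable_itv => t _ e' e'0; exists 1 => // s' _; rewrite subrr normr0.
rewrite ler_distl -mulrBl -mulrDl -!Rint_cst_itv//.
apply/andP; split; apply: le_Rintegral => // t; rewrite /= in_itv /= => /h;
  by rewrite ler_distl => /andP[].
Qed.

(** Real and imaginary parts are estimated separately, which costs the factor 2. *)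
Lemma cint_close g a b (c : C) e : a <= b -> pcont_itv g a b ->
  (forall t, a <= t <= b -> cabs (g t - c) <= e) ->
  cabs (cint g a b - c * (b - a)%:C) <= 2 * e * (b - a).
Proof.
move=> ab cg h.
have h1 := @Rint_close _ a b (Re c) e ab (integrable_Re cg).
have h2 := @Rint_close _ a b (Im c) e ab (integrable_Im cg).
apply: le_trans (cabs_le_ReIm _) _.
rewrite /cint; case: c h h1 h2 => c1 c2 h h1 h2; simpc => /=.
rewrite mulr2n mulrDl mul1r mulrDl; apply: lerD; [apply: h1|apply: h2] => t /h.
  by apply: le_trans; apply: le_trans (Re_le_cabs _); rewrite raddfB.
by apply: le_trans; apply: le_trans (Im_le_cabs _); rewrite raddfB.
Qed.

End Integral.

(** * Goursat's lemma *)

Section DyadicNesting.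
Variable R : realType.
Implicit Types (w h x y : R).

Lemma exp2_archi (a d : R) : 0 <= a -> 0 < d -> exists n, a / 2 ^+ n < d.
Proof.
move=> a0 d0; exists (Num.bound (a / d)).
have := archi_boundP (divr_ge0 a0 (ltW d0)); set n := Num.bound _ => hn.
rewrite ltr_pdivrMr ?exprn_gt0// mulrC -ltr_pdivrMr//.
apply: lt_le_trans hn _; rewrite -natrX ler_nat.
by rewrite ltnW// ltn_expl.
Qed.

(** Left endpoints increase and right endpoints decrease, so each left endpoint lies below each
    right endpoint; the supremum of the left endpoints is a common point. *)
Lemma nested_point (x : nat -> R) w : (forall n, x n <= x n.+1) ->
  (forall n, x n.+1 + w / 2 ^+ n.+1 <= x n + w / 2 ^+ n) -> 0 <= w ->
  exists p, forall n, x n <= p <= x n + w / 2 ^+ n.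
Proof.
move=> xl xr w0.
have incr m n : (m <= n)%N -> x m <= x n.
  by move=> /subnKC <-; elim: (n - m)%N => [|k IH]; rewrite ?addn0// addnS (le_trans IH).
have decr m n : (m <= n)%N -> x n + w / 2 ^+ n <= x m + w / 2 ^+ m.
  by move=> /subnKC <-; elim: (n - m)%N => [|k IH]; rewrite ?addn0// addnS (le_trans _ IH).
have pos n : 0 <= w / 2 ^+ n by rewrite divr_ge0// exprn_ge0.
have ub n : forall m, x m <= x n + w / 2 ^+ n.
  move=> m; have [mn|/ltnW nm] := leqP m n.
    by apply: le_trans (incr _ _ mn) _; rewrite lerDl.
  by apply: le_trans (decr _ _ nm); rewrite lerDl.
exists (sup (range x)) => n; apply/andP; split.
  apply: ub_le_sup; last by exists n.
  by exists (x 0%N + w / 2 ^+ 0) => _ [m _ <-].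
by apply: ge_sup; [exists (x 0%N), 0%N|move=> _ [m _ <-]].
Qed.

(** Bisection by choice of a bad piece at every scale. It serves rectangles in Goursat's lemma and,
    with h = 0, intervals in the mean value inequality. *)
Lemma dyadic_nesting (Bad : nat -> R -> R -> Prop) w h x0 y0 :
  0 <= w -> 0 <= h -> Bad 0%N x0 y0 ->
  (forall n x y, Bad n x y -> exists x' y', [/\ x <= x',
     x' + w / 2 ^+ n.+1 <= x + w / 2 ^+ n, y <= y',
     y' + h / 2 ^+ n.+1 <= y + h / 2 ^+ n & Bad n.+1 x' y']) ->
  exists px py, forall n, exists x y, [/\ Bad n x y,
    x <= px <= x + w / 2 ^+ n & y <= py <= y + h / 2 ^+ n].
Proof.
move=> w0 h0 B0 step.
have [F FP] : {F : nat * (R * R) -> R * R | forall n x y, Bad n x y ->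
   [/\ x <= (F (n, (x, y))).1, (F (n, (x, y))).1 + w / 2 ^+ n.+1 <= x + w / 2 ^+ n,
      y <= (F (n, (x, y))).2, (F (n, (x, y))).2 + h / 2 ^+ n.+1 <= y + h / 2 ^+ n &
      Bad n.+1 (F (n, (x, y))).1 (F (n, (x, y))).2]}.
  apply: cid; have /choice[F FP] : forall a : nat * (R * R), exists b : R * R,
    Bad a.1 a.2.1 a.2.2 -> [/\ a.2.1 <= b.1,
      b.1 + w / 2 ^+ a.1.+1 <= a.2.1 + w / 2 ^+ a.1, a.2.2 <= b.2,
      b.2 + h / 2 ^+ a.1.+1 <= a.2.2 + h / 2 ^+ a.1 & Bad a.1.+1 b.1 b.2].
    move=> [n [x y]] /=; have [/step[x' [y' ?]]|nB] := pselect (Bad n x y).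
      by exists (x', y').
    (* A dummy value where [Bad] fails; the sequence [s] below never meets this case. *)
    by exists (0, 0).
  by exists F => n x y /(FP (n, (x, y))).
pose s := fix s n := if n is m.+1 then F (m, s m) else (x0, y0).
have sB n : Bad n (s n).1 (s n).2.
  by elim: n => //= n IH; case: (s n) IH => a b /= /FP[].
have sP n : [/\ (s n).1 <= (s n.+1).1,
   (s n.+1).1 + w / 2 ^+ n.+1 <= (s n).1 + w / 2 ^+ n,
   (s n).2 <= (s n.+1).2 & (s n.+1).2 + h / 2 ^+ n.+1 <= (s n).2 + h / 2 ^+ n].
  by move: (sB n) => /=; case: (s n) => a b /= /FP[].
have [|||px pxP] := @nested_point (fun n => (s n).1) w; first by move=> n; case: (sP n).
- by move=> n; case: (sP n).
- by [].
have [|||py pyP] := @nested_point (fun n => (s n).2) h; first by move=> n; case: (sP n).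
- by move=> n; case: (sP n).
- by [].
by exists px, py => n; exists (s n).1, (s n).2.
Qed.

End DyadicNesting.

Section Goursat.
Variable R : realType.
Local Notation C := R[i].
Variable G : C -> C.
Implicit Types (x y : R).

(** The integral of G dz along the boundary, counterclockwise, with opposite sides combined into one
    integral. *)
Definition rect_int x0 x1 y0 y1 : C :=
  cint (fun x => G (x +i* y0) - G (x +i* y1)) x0 x1 +
  'i * cint (fun y => G (x1 +i* y) - G (x0 +i* y)) y0 y1.

Definition cdiff_rect x0 x1 y0 y1 :=
  forall x y, x0 <= x <= x1 -> y0 <= y <= y1 -> cdiff G (x +i* y).

Lemma pcont_horizontal x y : ccont G (x +i* y) -> pcont (fun x => G (x +i* y)) x.
Proof.
move=> cG e e0; have [d d0 h] := cG e e0; exists d => // s sx; apply: h.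
by rewrite (_ : _ - _ = (s - x)%:C) ?cabs_real//; simpc.
Qed.

Lemma pcont_vertical x y : ccont G (x +i* y) -> pcont (fun y => G (x +i* y)) y.
Proof.
move=> cG e e0; have [d d0 h] := cG e e0; exists d => // s sx; apply: h.
by rewrite (_ : _ - _ = 0 +i* (s - y)) ?cabs_im//; simpc.
Qed.

Lemma pcontB (f g : R -> C) t : pcont f t -> pcont g t -> pcont (fun s => f s - g s) t.
Proof.
move=> cf cg e e0; have e20 : 0 < e / 2 by lra.
have [d d0 fd] := cf _ e20; have [d' d'0 gd] := cg _ e20.
exists (Num.min d d'); first by rewrite lt_min d0.
move=> w; rewrite lt_min => /andP[/fd h1 /gd h2].
rewrite (_ : _ - _ = (f w - f t) - (g w - g t)); last by ring.
by apply: le_lt_trans (cabsB _ _) _; lra.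
Qed.

(** The common side at xm is traversed in both directions and cancels. *)
Lemma rect_int_splitx x0 xm x1 y0 y1 : x0 <= xm <= x1 -> y0 <= y1 ->
  cdiff_rect x0 x1 y0 y1 ->
  rect_int x0 x1 y0 y1 = rect_int x0 xm y0 y1 + rect_int xm x1 y0 y1.
Proof.
move=> /andP[xm0 xm1] y01 D.
have cv x : x0 <= x <= x1 -> pcont_itv (fun y => G (x +i* y)) y0 y1.
  by move=> hx t ht; apply/pcont_vertical/cdiff_ccont/D.
have ch y : y0 <= y <= y1 -> pcont_itv (fun x => G (x +i* y)) x0 x1.
  by move=> hy t ht; apply/pcont_horizontal/cdiff_ccont/D.
rewrite /rect_int (@cint_split _ _ x0 xm x1) ?xm0//; last first.
  by move=> t ht; apply: pcontB; apply: ch => //; rewrite ?lexx ?y01.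
rewrite !(@cintB _ _ _ y0 y1); try by apply: cv; rewrite ?lexx ?xm0 ?xm1 ?(le_trans xm0).
by ring.
Qed.

Lemma rect_int_splity x0 x1 y0 ym y1 : y0 <= ym <= y1 -> x0 <= x1 ->
  cdiff_rect x0 x1 y0 y1 ->
  rect_int x0 x1 y0 y1 = rect_int x0 x1 y0 ym + rect_int x0 x1 ym y1.
Proof.
move=> /andP[ym0 ym1] x01 D.
have cv x : x0 <= x <= x1 -> pcont_itv (fun y => G (x +i* y)) y0 y1.
  by move=> hx t ht; apply/pcont_vertical/cdiff_ccont/D.
have ch y : y0 <= y <= y1 -> pcont_itv (fun x => G (x +i* y)) x0 x1.
  by move=> hy t ht; apply/pcont_horizontal/cdiff_ccont/D.
rewrite /rect_int (@cint_split _ _ y0 ym y1) ?ym0//; last first.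
  by move=> t ht; apply: pcontB; apply: cv => //; rewrite ?lexx ?x01.
rewrite !(@cintB _ _ _ x0 x1); try by apply: ch; rewrite ?lexx ?ym0 ?ym1 ?(le_trans ym0).
by ring.
Qed.

Lemma cdiff_rect_sub x0 x1 y0 y1 x0' x1' y0' y1' :
  x0 <= x0' -> x1' <= x1 -> y0 <= y0' -> y1' <= y1 ->
  cdiff_rect x0 x1 y0 y1 -> cdiff_rect x0' x1' y0' y1'.
Proof.
move=> h1 h2 h3 h4 D x y /andP[a b] /andP[c d].
by apply: D; apply/andP; split; lra.
Qed.

(** Let S be half the perimeter. On opposite sides G differs by l times the constant displacement,
    up to 2 e S. The two main terms are -i l and +i l times the area and cancel; the errors, doubled
    by [cint_close], add up to 4 e S per unit of half perimeter. *)
Lemma rect_int_local x0 x1 y0 y1 px py l e : 0 <= e ->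
  cdiff_rect x0 x1 y0 y1 -> x0 <= px <= x1 -> y0 <= py <= y1 ->
  (forall w, cabs (w - (px +i* py)) <= (x1 - x0) + (y1 - y0) ->
    cabs (G w - G (px +i* py) - l * (w - (px +i* py))) <=
      e * cabs (w - (px +i* py))) ->
  cabs (rect_int x0 x1 y0 y1) <= 4 * e * ((x1 - x0) + (y1 - y0)) ^+ 2.
Proof.
move=> e0 D hpx hpy loc.
have x01 : x0 <= x1 by move/andP: hpx => [] ? ?; lra.
have y01 : y0 <= y1 by move/andP: hpy => [] ? ?; lra.
pose S := (x1 - x0) + (y1 - y0).
pose A w := G (px +i* py) + l * (w - (px +i* py)).
have near x y : x0 <= x <= x1 -> y0 <= y <= y1 ->
    cabs (G (x +i* y) - A (x +i* y)) <= e * S.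
  move=> /andP[a b] /andP[c d].
  have hS : cabs (x +i* y - px +i* py) <= S.
    apply: le_trans (cabs_le_ReIm _) _; simpc => /=.
    move/andP: hpx => [] ? ?; move/andP: hpy => [] ? ?; rewrite /S.
    by apply: lerD; rewrite ler_norml; apply/andP; split; lra.
  rewrite /A opprD addrA; apply: le_trans (loc _ hS) _.
  by rewrite ler_wpM2l.
have cv x : x0 <= x <= x1 -> pcont_itv (fun y => G (x +i* y)) y0 y1.
  by move=> hx t ht; apply/pcont_vertical/cdiff_ccont/D.
have ch y : y0 <= y <= y1 -> pcont_itv (fun x => G (x +i* y)) x0 x1.
  by move=> hy t ht; apply/pcont_horizontal/cdiff_ccont/D.
have ex : forall w w', cabs (G w - A w) <= e * S -> cabs (G w' - A w') <= e * S ->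
    cabs (G w - G w' - l * (w - w')) <= 2 * (e * S).
  move=> w w' h1 h2.
  rewrite (_ : _ - _ = (G w - A w) - (G w' - A w')); last by rewrite /A; ring.
  by apply: le_trans (cabsB _ _) _; lra.
have b1 : cabs (cint (fun x => G (x +i* y0) - G (x +i* y1)) x0 x1 -
    l * (0 +i* (y0 - y1)) * (x1 - x0)%:C) <= 2 * (2 * (e * S)) * (x1 - x0).
  apply: cint_close => // [t ht|t ht].
    by apply: pcontB; apply: ch => //; rewrite lexx y01.
  have := ex (t +i* y0) (t +i* y1).
  rewrite (_ : t +i* y0 - t +i* y1 = 0 +i* (y0 - y1)); last by simpc.
  by apply; apply: near => //; rewrite lexx y01.
have b2 : cabs (cint (fun y => G (x1 +i* y) - G (x0 +i* y)) y0 y1 -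
    l * (x1 - x0)%:C * (y1 - y0)%:C) <= 2 * (2 * (e * S)) * (y1 - y0).
  apply: cint_close => // [t ht|t ht].
    by apply: pcontB; apply: cv => //; rewrite lexx x01.
  have := ex (x1 +i* t) (x0 +i* t).
  rewrite (_ : x1 +i* t - x0 +i* t = (x1 - x0)%:C); last by simpc.
  by apply; apply: near => //; rewrite lexx x01.
rewrite /rect_int; set I1 := cint _ _ _ in b1 *; set I2 := cint _ _ _ in b2 *.
have -> : I1 + 'i * I2 = (I1 - l * (0 +i* (y0 - y1)) * (x1 - x0)%:C) +
   'i * (I2 - l * (x1 - x0)%:C * (y1 - y0)%:C).
  have -> : 0 +i* (y0 - y1) = - ('i * (y1 - y0)%:C).
    by apply/eqP; rewrite eq_complex /=; apply/andP; split; apply/eqP; ring.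
  by ring.
apply: le_trans (cabsD _ _) _; rewrite cabsM cabs_im normr1 mul1r -/S.
apply: le_trans (lerD b1 b2) _; rewrite -mulrDr -/S.
by rewrite le_eqVlt; apply/orP; left; apply/eqP; ring.
Qed.

(** The integral is the sum over the four quarters, so one of them carries more than a quarter of
    the bound. *)
Lemma rect_int_quarter x y a b s : 0 <= a -> 0 <= b ->
  cdiff_rect x (x + (a + a)) y (y + (b + b)) ->
  4 * s < cabs (rect_int x (x + (a + a)) y (y + (b + b))) ->
  exists x' y', [/\ x <= x', x' + a <= x + (a + a), y <= y',
    y' + b <= y + (b + b) & s < cabs (rect_int x' (x' + a) y' (y' + b))].
Proof.
rewrite (addrA x a a) (addrA y b b) => a0 b0 D.
have Dl : cdiff_rect x (x + a) y (y + b + b) by apply: cdiff_rect_sub D; lra.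
have Dr : cdiff_rect (x + a) (x + a + a) y (y + b + b).
  by apply: cdiff_rect_sub D; lra.
have ha : x <= x + a <= x + a + a by apply/andP; split; lra.
have hb : y <= y + b <= y + b + b by apply/andP; split; lra.
rewrite (rect_int_splitx ha)//; last by lra.
rewrite (rect_int_splity hb _ Dl); last by lra.
rewrite (rect_int_splity hb _ Dr); last by lra.
rewrite [r in 4 * s < cabs r]addrA; move=> big; apply: contrapT => /forallNP none.
have small x' y' : x <= x' -> x' + a <= x + a + a -> y <= y' ->
    y' + b <= y + b + b -> cabs (rect_int x' (x' + a) y' (y' + b)) <= s.
  move=> k1 k2 k3 k4; rewrite leNgt; apply/negP => k5.
  by apply: (none x'); exists y'; split.
have := small x y; have := small x (y + b).
have := small (x + a) y; have := small (x + a) (y + b).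
move: big; move: (rect_int _ _ _ _) (rect_int _ _ _ _).
move: (rect_int _ _ _ _) (rect_int _ _ _ _) => r4 r3 r2 r1 big h4 h3 h2 h1.
have q1 : cabs r1 <= s by apply: h1; lra.
have q2 : cabs r2 <= s by apply: h2; lra.
have q3 : cabs r3 <= s by apply: h3; lra.
have q4 : cabs r4 <= s by apply: h4; lra.
have := cabsD (r1 + r2 + r3) r4; have := cabsD (r1 + r2) r3; have := cabsD r1 r2.
by lra.
Qed.

Lemma goursat x0 x1 y0 y1 : x0 <= x1 -> y0 <= y1 -> cdiff_rect x0 x1 y0 y1 ->
  rect_int x0 x1 y0 y1 = 0.
Proof.
move=> x01 y01 D.
pose w := x1 - x0; pose h := y1 - y0; pose S := w + h.
have w0 : 0 <= w by rewrite /w; lra.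
have h0 : 0 <= h by rewrite /h; lra.
have S0 : 0 <= S by rewrite /S; lra.
suff bound (e : R) : 0 < e -> cabs (rect_int x0 x1 y0 y1) <= 4 * e * S ^+ 2.
  apply: cabs_eq0; apply/eqP; rewrite eq_le cabs_ge0 andbT.
  apply/ler_addgt0Pr => e e0; rewrite add0r.
  have k0 : 0 < 4 * (S ^+ 2 + 1) by have := sqr_ge0 S; lra.
  have e'0 : 0 < e / (4 * (S ^+ 2 + 1)) by rewrite divr_gt0.
  apply: le_trans (bound _ e'0) _.
  rewrite (_ : 4 * _ * _ = e * (4 * S ^+ 2) / (4 * (S ^+ 2 + 1))); last by ring.
  by rewrite ler_pdivrMr// ler_wpM2l// ?ltW//; lra.
move=> e0; rewrite leNgt; apply/negP => big.
(* The threshold drops by the factor 4 at each halving, as [rect_int_quarter] provides, and is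
   exactly the bound that [rect_int_local] gives near the limit point. *)
pose Bad n x y := [/\ x0 <= x, x + w / 2 ^+ n <= x1, y0 <= y, y + h / 2 ^+ n <= y1 &
  4 * e * (S / 2 ^+ n) ^+ 2 <
    cabs (rect_int x (x + w / 2 ^+ n) y (y + h / 2 ^+ n))].
have half (t : R) n : t / 2 ^+ n = t / 2 ^+ n.+1 + t / 2 ^+ n.+1.
  by rewrite exprS; field; rewrite expf_neq0// pnatr_eq0.
have posn (t : R) n : 0 <= t -> 0 <= t / 2 ^+ n.
  by move=> t0; rewrite divr_ge0// exprn_ge0.
have [|n x y|px [py nest]] := @dyadic_nesting _ Bad w h x0 y0 w0 h0.
- rewrite /Bad !expr0 !divr1 /w /h.
  by split; rewrite ?lexx//; try lra; rewrite !(addrC _ (_ - _)) !subrK.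
- case=> hx hx' hy hy' hbig.
  move: hx' hy' hbig; rewrite (half w n) (half h n) => hx' hy' hbig.
  have [||||x' [y' [k1 k2 k3 k4 k5]]] := @rect_int_quarter x y (w / 2 ^+ n.+1)
    (h / 2 ^+ n.+1) (4 * e * (S / 2 ^+ n.+1) ^+ 2).
  + exact: posn.
  + exact: posn.
  + by apply: cdiff_rect_sub D.
  + by apply: le_lt_trans hbig; rewrite (half S n) le_eqVlt; apply/orP; left; apply/eqP; ring.
  exists x', y'; split=> //; split=> //.
  + exact: le_trans k1.
  + exact: le_trans hx'.
  + exact: le_trans k3.
  + exact: le_trans hy'.
have Bsub n x y : Bad n x y ->
    cdiff_rect x (x + w / 2 ^+ n) y (y + h / 2 ^+ n).
  by case=> *; apply: cdiff_rect_sub D.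
have [l Dl] : cdiff G (px +i* py).
  have [x [y [B hx hy]]] := nest 0%N.
  exact: Bsub B _ _ hx hy.
have [d d0 hd] := (cderiv_epsP _ _ _).1 Dl e e0.
have [n hn] := exp2_archi S0 d0.
have [x [y [B hx hy]]] := nest n.
have := rect_int_local (ltW e0) (Bsub _ _ _ B) hx hy (l := l).
have hSn : x + w / 2 ^+ n - x + (y + h / 2 ^+ n - y) = S / 2 ^+ n.
  by rewrite /S; ring.
rewrite hSn => /(_ (fun w hw => hd w (le_lt_trans hw hn))).
by case: B => _ _ _ _; rewrite ltNge => /negP.
Qed.

End Goursat.

(** * Mean value property *)

(** The field is general because this is used over [R], for exp, cos and sin, and over [R[i]], for
    the complex derivative. *)
Lemma is_derive_eps (K : numFieldType) (f : K -> K) (z l : K) :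
  is_derive z 1 f l -> forall e, 0 < e -> exists2 d, 0 < d &
    forall w, `|w - z| < d -> `|f w - f z - l * (w - z)| <= e * `|w - z|.
Proof.
move=> Df e e0.
have := @ex_derive _ _ _ _ _ _ _ Df; rewrite /derivable => /cvgrPdist_le /(_ e e0).
rewrite -/('D_1 f z) (@derive_val _ _ _ _ _ _ _ Df).
move=> /nbhs_ballP[d /= d0 h]; exists d => // w wz.
have [->|wz0] := eqVneq w z; first by rewrite !subrr mulr0 subrr normr0 mulr0.
have wz1 : w - z != 0 by rewrite subr_eq0.
have := h (w - z); rewrite /ball /= sub0r normrN => /(_ wz wz1).
rewrite /GRing.scale /= mulr1 subrK => hw.
rewrite (_ : f w - f z - _ = - ((l - (w - z)^-1 * (f w - f z)) * (w - z))).
  by rewrite normrN normrM ler_wpM2r.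
by field.
Qed.

Section Bridge.
Variable R : realType.
Local Notation C := R[i].

Lemma derivable_cderiv (f : C -> C) z : derivable f z 1 -> cderiv f z ('D_1 f z).
Proof.
move=> df; apply/cderiv_epsP => e e0.
have eC : 0 < e%:C by rewrite ltcR.
have [d d0 h] := @is_derive_eps _ f z _ (derivableP df) _ eC.
(* A positive element of [R[i]] is real. *)
have dR : d = (complex.Re d)%:C by rewrite RRe_real// gtr0_real.
exists (complex.Re d); first by move: d0; rewrite dR ltcR.
move=> w wz; have := h w; rewrite !normc_cabs dR ltcR => /(_ wz).
by rewrite -rmorphM /= lecR.
Qed.

End Bridge.

Section Cexp.
Variable R : realType.
Local Notation C := R[i].
Local Notation Re := (@complex.Re R).
Local Notation Im := (@complex.Im R).

Definition cexp (z : C) : C := (expR (Re z) * cos (Im z)) +i* (expR (Re z) * sin (Im z)).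

Lemma cexpD z w : cexp (z + w) = cexp z * cexp w.
Proof.
rewrite /cexp; case: z w => [a b] [c d] /=; rewrite expRD cosD sinD; simpc.
by congr (_ +i* _); ring.
Qed.

Lemma cexp0 : cexp 0 = 1.
Proof. by rewrite /cexp /= expR0 cos0 sin0 mulr0 mulr1. Qed.

Lemma cabs_cexp z : cabs (cexp z) = expR (Re z).
Proof.
rewrite /cexp /cabs /= !exprMn -mulrDr cos2Dsin2 mulr1 sqrtr_sqr.
by rewrite ger0_norm// expR_ge0.
Qed.

Lemma cderiv_cexp0 : cderiv cexp 0 1.
Proof.
apply/cderiv_epsP => e e0.
(* The four error terms [T1] to [T4] add up to at most 7 n |w|, whence e / 8; n <= 1 / 2 keeps |1 +
   x| and exp x below 2. *)
have [n [n0 n1 ne]] : exists n : R, [/\ 0 < n, n <= 1 / 2 & n <= e / 8].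
  exists (Num.min (1 / 2) (e / 8)); split; rewrite ?lt_min ?ge_min ?lexx ?orbT//.
  by apply/andP; split; lra.
have [d1 d10 h1] := is_derive_eps (is_derive_expR (0 : R)) n0.
have [d2 d20 h2] := is_derive_eps (is_derive_cos (0 : R)) n0.
have [d3 d30 h3] := is_derive_eps (is_derive_sin (0 : R)) n0.
exists (Num.min (Num.min d1 n) (Num.min d2 d3)); first by rewrite !lt_min d10 n0 d20.
move=> w; rewrite subr0 cexp0 mul1r !lt_min -!andbA => /and4P[w1 w2 w3 w4].
have hx := Re_le_cabs w; have hy := Im_le_cabs w.
move: (h1 (Re w)) (h2 (Im w)) (h3 (Im w)); rewrite !subr0 expR0 cos0 sin0.
rewrite oppr0 mul0r mul1r !subr0 mul1r.
move=> /(_ (le_lt_trans hx w1)) k1 /(_ (le_lt_trans hy w3)) k2.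
move=> /(_ (le_lt_trans hy w4)) k3.
apply: le_trans (cabs_le_ReIm _) _.
move: hx hy k1 k2 k3; rewrite /cexp; case: w w1 w2 w3 w4 => x y w1 w2 w3 w4 /=.
simpc => /=; set A := cabs _ in w1 w2 w3 w4 *.
have c1 := cos_max y.
set E := expR x; set c := cos y in c1 *; set s := sin y => hx hy k1 k2 k3.
have -> : E * c - 1 - x = (E - 1 - x) * c + (1 + x) * (c - 1) by ring.
have -> : E * s - y = E * (s - y) + (E - 1) * y by ring.
have xn : `|x| <= 1 / 2 by apply: le_trans hx _; lra.
have yn : `|y| <= n by apply: le_trans hy _; lra.
have xx := normr_ge0 x; have yy := normr_ge0 y.
have E1 : `|E - 1| <= 2 * `|x|.
  rewrite (_ : E - 1 = (E - 1 - x) + x); last by ring.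
  by apply: le_trans (ler_normD _ _) _; nra.
have EE : `|E| <= 2.
  rewrite (_ : E = (E - 1) + 1); last by ring.
  by apply: le_trans (ler_normD _ _) _; rewrite normr1; lra.
have T1 : `|(E - 1 - x) * c| <= n * A.
  rewrite normrM; apply: le_trans (_ : `|E - 1 - x| * 1 <= _); first by rewrite ler_wpM2l.
  by rewrite mulr1; apply: le_trans k1 _; rewrite ler_wpM2l// ltW.
have T2 : `|(1 + x) * (c - 1)| <= 2 * (n * A).
  rewrite normrM; apply: ler_pM => //.
    by apply: le_trans (ler_normD _ _) _; rewrite normr1; lra.
  by apply: le_trans k2 _; rewrite ler_wpM2l// ltW.
have T3 : `|E * (s - y)| <= 2 * (n * A).
  rewrite normrM; apply: ler_pM => //.
  by apply: le_trans k3 _; rewrite ler_wpM2l// ltW.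
have T4 : `|(E - 1) * y| <= 2 * A * n.
  by rewrite normrM; apply: ler_pM => //; lra.
have A0 : 0 <= A by rewrite /A.
apply: le_trans (lerD (ler_normD _ _) (ler_normD _ _)) _.
by nra.
Qed.

(** The functional equation exp w = exp z exp (w - z) reduces this to the derivative at 0. *)
Lemma cderiv_cexp z : cderiv cexp z (cexp z).
Proof.
have sh : cderiv (fun w => w + - z) z (1 + 0).
  by apply: cderivD; [exact: cderiv_id|exact: cderiv_cst].
have := cderivM (cderiv_cst (cexp z) z) (@cderiv_comp _ _ cexp z _ 1 sh _).
rewrite subrr => /(_ cderiv_cexp0).
rewrite mul0r addr0 addr0 !mulr1; apply: cderiv_local ltr01 _ => w _.
by rewrite -cexpD addrC subrK.
Qed.

Lemma cexp_2pi x : cexp (x +i* (2 * pi)) = cexp (x +i* 0).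
Proof. by rewrite /cexp /= mulr_natl cos2pi sin2pi cos0 sin0. Qed.

(* The rectangle [x0, x1] x [0, 2 pi] is mapped by exp onto an annulus, and the
   horizontal sides cancel; letting x0 tend to -oo gives the mean value
   property.  The factor 2 comes from bounding real and imaginary parts
   separately; it disappears in cabs_center_le. *)
Lemma cabs_center_le2 (H : C -> C) (s B : R) : 0 < s < 1 ->
  (forall z, cabs z < 1 -> cdiff H z) ->
  (forall z, cabs z = s -> cabs (H z) <= B) -> cabs (H 0) <= 2 * B.
Proof.
move=> /andP[s0 s1] D hB.
pose G z := H (cexp z).
have DG x y : expR x < 1 -> cdiff G (x +i* y).
  move=> hx; apply: cdiff_comp; first by eexists; exact: cderiv_cexp.
  by apply: D; rewrite cabs_cexp.
have p0 : 0 < 2 * pi :> R by have := pi_gt0 R; lra.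
suff bound e : 0 < e -> cabs (H 0) <= 2 * B + 2 * e.
  apply/ler_addgt0Pr => e e0; have e20 : 0 < e / 2 by lra.
  by have := bound _ e20; lra.
move=> e0.
have cz : cabs (0 : C) < 1 by rewrite cabs0.
have [d d0 hd] := cdiff_ccont (D _ cz) e0.
(* On the circle of radius r, H is within e of H 0, so the integral over the inner side is close to
   2 pi H 0. *)
pose r := Num.min s (d / 2).
have r0 : 0 < r by rewrite lt_min s0; lra.
have rs : r <= s by rewrite ge_min lexx.
have rd : r < d by rewrite gt_min; apply/orP; right; lra.
have lnrs : ln r <= ln s by rewrite ler_ln// posrE.
have DR : cdiff_rect G (ln r) (ln s) 0 (2 * pi).
  move=> x y /andP[_ hx] _; apply: DG; apply: le_lt_trans s1.
  by rewrite -(@lnK _ s) ?posrE// ler_expR.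
have := goursat lnrs (ltW p0) DR; rewrite /rect_int.
have cG x : expR x < 1 -> pcont_itv (fun y => G (x +i* y)) 0 (2 * pi).
  by move=> hx t ht; apply/pcont_vertical/cdiff_ccont/DG.
have -> : cint (fun x => G (x +i* 0) - G (x +i* (2 * pi))) (ln r) (ln s) = 0.
  have -> : (fun x => G (x +i* 0) - G (x +i* (2 * pi))) = (fun=> 0).
    by apply/funext => x; rewrite /G cexp_2pi subrr.
  have : cabs (cint (fun=> 0) (ln r) (ln s) - 0 * (ln s - ln r)%:C) <=
      2 * 0 * (ln s - ln r).
    apply: cint_close => // t _; last by rewrite subrr cabs0.
    by move=> e' e'0; exists 1 => // t' _; rewrite subrr cabs0.
  rewrite mul0r subr0 mulr0 mul0r => k.
  by apply: cabs_eq0; apply/eqP; rewrite eq_le cabs_ge0 andbT.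
rewrite add0r => /eqP; rewrite mulf_eq0 => /orP[/eqP[] /eqP|/eqP].
  by rewrite oner_eq0.
have e_s : expR (ln s) < 1 by rewrite lnK ?posrE.
have e_r : expR (ln r) < 1 by rewrite lnK ?posrE//; lra.
rewrite cintB; [|exact: cG|exact: cG] => /eqP; rewrite subr_eq0 => /eqP eqI.
have h1 := @cint_close _ (fun y => G (ln s +i* y)) 0 (2 * pi) 0 B (ltW p0) (cG _ e_s).
have h2 := @cint_close _ (fun y => G (ln r +i* y)) 0 (2 * pi) (H 0) e (ltW p0) (cG _ e_r).
move: h1 h2; rewrite eqI mul0r !subr0; set I := cint _ _ _ => h1 h2.
have k1 : cabs I <= 2 * B * (2 * pi).
  by apply: h1 => t _; rewrite subr0; apply: hB; rewrite cabs_cexp /= lnK ?posrE.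
have k2 : cabs (I - H 0 * (2 * pi)%:C) <= 2 * e * (2 * pi).
  apply: h2 => t _; apply/ltW/hd.
  by rewrite subr0 cabs_cexp /= lnK ?posrE.
have : cabs (H 0 * (2 * pi)%:C) <= (2 * B + 2 * e) * (2 * pi).
  rewrite (_ : H 0 * _ = I - (I - H 0 * (2 * pi)%:C)); last by ring.
  by apply: le_trans (cabsB _ _) _; lra.
by rewrite cabsM cabs_real gtr0_norm// ler_pM2r.
Qed.

(** Constants are lost under n-th roots: if x > b > 0, Bernoulli's inequality makes (x / b)^n exceed
    K. *)
Lemma expr_le_root (x b K : R) : 0 <= x -> 0 <= b ->
  (forall n, x ^+ n <= K * b ^+ n) -> x <= b.
Proof.
move=> x0 b0 h; rewrite leNgt; apply/negP => bx.
have [b00|bn0] := eqVneq b 0.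
  by have := h 1%N; rewrite b00 !expr1 mulr0; lra.
have bp : 0 < b by rewrite lt_def bn0.
pose t := x / b - 1.
have t0 : 0 < t by rewrite /t subr_gt0 ltr_pdivlMr// mul1r.
have hn n : n%:R * t <= K.
  have : (x / b) ^+ n <= K by rewrite expr_div_n ler_pdivrMr// exprn_gt0.
  apply: le_trans; rewrite (_ : x / b = 1 + t); last by rewrite /t; ring.
  elim: n => [|n IH]; first by rewrite mul0r expr0.
  rewrite exprS -natr1.
  have : 0 <= n%:R * t by rewrite mulr_ge0// ltW.
  have : 1 + n%:R * t <= (1 + t) ^+ n.
    clear -t0; elim: n => [|n IH]; first by rewrite mul0r expr0 addr0.
    rewrite exprS -natr1; apply: le_trans (_ : (1 + t) * (1 + n%:R * t) <= _); last first.
      by rewrite ler_wpM2l//; lra.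
    have : 0 <= n%:R * (t * t) by rewrite mulr_ge0// mulr_ge0// ltW.
    by lra.
  by move=> *; nra.
have K0 : 0 <= K by have := hn 0%N; rewrite mul0r.
have := archi_boundP (divr_ge0 K0 (ltW t0)); rewrite ltr_pdivrMr//.
by have := hn (Num.bound (K / t)); lra.
Qed.

(** The weaker estimate is applied to all powers of H. *)
Lemma cabs_center_le (H : C -> C) (s B : R) : 0 < s < 1 -> 0 <= B ->
  (forall z, cabs z < 1 -> cdiff H z) ->
  (forall z, cabs z = s -> cabs (H z) <= B) -> cabs (H 0) <= B.
Proof.
move=> s01 B0 D hB; apply: (@expr_le_root _ _ 2) => // n.
rewrite -cabsX; apply: (@cabs_center_le2 (fun z => H z ^+ n)) s01 _ _.
  by move=> z /D; exact: cdiffX.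
by move=> z /hB h; rewrite cabsX; apply: lerXn2r; rewrite ?nnegrE.
Qed.

End Cexp.

(** * Maximum principle and Schwarz-Pick *)

Section MaximumPrinciple.
Variable R : realType.
Local Notation C := R[i].
Implicit Types (a z w : C) (f g P q H : C -> C).

(** The disk automorphism taking 0 to a, for |a| < 1; its inverse is [mob (- a)]. *)
Definition mob a w : C := (w + a) / (1 + a^* * w).

Lemma mob_den_gt0 a w : cabs a < 1 -> cabs w < 1 ->
  0 < 1 - cabs a /\ 1 - cabs a <= cabs (1 + a^* * w).
Proof.
move=> a1 w1; split; first by lra.
have := cabs_sub 1 (- (a^* * w)); rewrite opprK cabs1 cabsN cabsM cabs_conj.
have := cabs_ge0 a; have := cabs_ge0 w.
by move=> *; nra.
Qed.

Lemma mob_den a w : cabs a < 1 -> cabs w < 1 -> 1 + a^* * w != 0.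
Proof. by move=> a1 w1; have [h1 h2] := mob_den_gt0 a1 w1; apply: cabs_neq0; lra. Qed.

Lemma cabs_mob_den a w : cabs (1 + a^* * w) ^+ 2 - cabs (w + a) ^+ 2 =
  (1 - cabs a ^+ 2) * (1 - cabs w ^+ 2).
Proof. by rewrite !cabs_sqr; case: a w => [a b] [c d] /=; simpc => /=; ring. Qed.

Lemma cabs_mob a w : cabs a < 1 -> cabs w < 1 ->
  1 - cabs (mob a w) ^+ 2 =
  (1 - cabs a ^+ 2) * (1 - cabs w ^+ 2) / cabs (1 + a^* * w) ^+ 2.
Proof.
move=> a1 w1; rewrite -cabs_mob_den /mob cabsM cabsV.
have [h1 h2] := mob_den_gt0 a1 w1.
have h3 : cabs (1 + a^* * w) != 0 by rewrite gt_eqF//; lra.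
by field.
Qed.

Lemma sqr_lt1 (x : R) : 0 <= x -> (x ^+ 2 < 1) = (x < 1).
Proof. by move=> x0; rewrite -{1}(expr1n R 2) ltr_pXn2r// nnegrE. Qed.

Lemma mob_disk a w : cabs a < 1 -> cabs w < 1 -> cabs (mob a w) < 1.
Proof.
move=> a1 w1; rewrite -sqr_lt1// -subr_gt0 cabs_mob//.
have [h1 h2] := mob_den_gt0 a1 w1.
apply: divr_gt0; last by apply: exprn_gt0; lra.
by apply: mulr_gt0; rewrite subr_gt0 sqr_lt1.
Qed.

Lemma conjcN z : ((- z)^* = - z^*)%R. Proof. by case: z. Qed.

Lemma mobK a w : cabs a < 1 -> cabs w < 1 -> mob (- a) (mob a w) = w.
Proof.
move=> a1 w1; have d0 := mob_den a1 w1; rewrite /mob conjcN.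
have aa : 1 - a * a^* != 0.
  apply: cabs_neq0; apply: lt_le_trans (cabs_sub _ _).
  by rewrite cabs1 -sqr_cabs cabs_real ger0_norm ?sqr_ge0// subr_gt0 sqr_lt1.
have -> : (w + a) / (1 + a^* * w) + - a = w * (1 - a * a^*) / (1 + a^* * w).
  by field.
have -> : 1 + - a^* * ((w + a) / (1 + a^* * w)) = (1 - a * a^*) / (1 + a^* * w).
  by field.
by field; rewrite d0.
Qed.

Lemma mob0 a : mob a 0 = a.
Proof. by rewrite /mob mulr0 addr0 add0r divr1. Qed.

Lemma mobNK a w : cabs a < 1 -> cabs w < 1 -> mob a (mob (- a) w) = w.
Proof. by move=> a1 w1; rewrite -{1}(opprK a) mobK// cabsN. Qed.

Lemma cderiv_mob a w : cabs a < 1 -> cabs w < 1 ->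
  cderiv (mob a) w ((1 - cabs a ^+ 2)%:C / (1 + a^* * w) ^+ 2).
Proof.
move=> a1 w1; have d0 := mob_den a1 w1.
have n : cderiv (fun z => z + a) w (1 + 0).
  by apply: cderivD; [exact: cderiv_id|exact: cderiv_cst].
have d : cderiv (fun z => 1 + a^* * z) w (0 + (a^* * 1 + 0 * w)).
  apply: cderivD; first exact: cderiv_cst.
  by apply: cderivM; [exact: cderiv_cst|exact: cderiv_id].
have := cderivM n (cderiv_comp d (cderivV d0)).
congr cderiv; rewrite rmorphB /= sqr_cabs; first by rewrite rmorph1; field.
Qed.

Lemma cdiff_mob a w : cabs a < 1 -> cabs w < 1 -> cdiff (mob a) w.
Proof. by move=> a1 w1; eexists; exact: cderiv_mob. Qed.

(** The automorphism [mob w] moves the point w to the centre and carries a circle close to the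
    boundary into the annulus where H is bounded by B. *)
Lemma maximum_principle H B s0 : 0 <= B -> s0 < 1 ->
  (forall z, cabs z < 1 -> cdiff H z) ->
  (forall z, s0 < cabs z -> cabs z < 1 -> cabs (H z) <= B) ->
  forall w, cabs w < 1 -> cabs (H w) <= B.
Proof.
move=> B0; wlog s00 : s0 / 0 <= s0 => [wl s1 D hB|s1 D hB w w1].
  apply: (wl (Num.max s0 0)) => //; first by rewrite le_max lexx orbT.
    by rewrite gt_max s1 ltr01.
  by move=> z; rewrite gt_max => /andP[/hB].
(* As |1 + w^* z| >= 1 - |w|, one has 1 - |mob w z|^2 <= K (1 - |z|^2) <= 2 K n for |z| = 1 - n; n
   makes this less than 1 - s0^2. *)
pose K := (1 - cabs w ^+ 2) / (1 - cabs w) ^+ 2.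
have w2 : 0 < 1 - cabs w by lra.
have K0 : 0 < K.
  by apply: divr_gt0; [rewrite subr_gt0 sqr_lt1|exact: exprn_gt0].
have s2 : 0 < 1 - s0 ^+ 2 by rewrite subr_gt0 sqr_lt1.
pose n := Num.min (1 / 2) ((1 - s0 ^+ 2) / (4 * K)).
have n0 : 0 < n by rewrite lt_min divr_gt0 ?divr_gt0//; lra.
have n1 : n <= 1 / 2 by rewrite ge_min lexx.
have n2 : n * (4 * K) <= 1 - s0 ^+ 2.
  by rewrite -ler_pdivlMr ?ge_min ?lexx ?orbT//; lra.
rewrite -(mob0 w); apply: (@cabs_center_le _ (fun z => H (mob w z)) (1 - n)) => //.
- by apply/andP; split; lra.
- move=> z z1; apply: cdiff_comp; first exact: cdiff_mob.
  by apply: D; exact: mob_disk.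
move=> z zn; have z1 : cabs z < 1 by lra.
apply: hB; last exact: mob_disk.
rewrite -(@ltr_pXn2r _ 2)// ?nnegrE//.
have [_ hd] := mob_den_gt0 w1 z1.
have : 1 - cabs (mob w z) ^+ 2 <= K * (2 * n).
  rewrite cabs_mob// /K mulrAC.
  have w3 : 0 < 1 - cabs w ^+ 2 by rewrite subr_gt0 sqr_lt1.
  apply: ler_pM.
  + by rewrite ltW// divr_gt0 ?exprn_gt0//; lra.
  + by rewrite subr_ge0 ltW// sqr_lt1.
  + rewrite ler_pM2l// lef_pV2 ?posrE ?exprn_gt0//; last by lra.
    by rewrite ler_pXn2r// nnegrE; lra.
  + by rewrite zn; nra.
by have := mulr_gt0 K0 n0; lra.
Qed.

(* Multiplying q^n by P^2 makes it differentiable at the zeros of P; the factor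
   P^2 is then lost in the limit of n-th roots. *)
Lemma quotient_maximum_principle P q B s0 : 0 <= B -> s0 < 1 ->
  (forall z, cabs z < 1 -> cdiff P z) ->
  (forall z, cabs z < 1 -> cabs (P z) <= 1) ->
  (forall z, cabs z < 1 -> P z != 0 -> cdiff q z) ->
  (forall z, cabs z < 1 -> P z = 0 -> exists K d, 0 < d /\
     forall w, cabs (w - z) < d -> cabs (q w) <= K) ->
  (forall z, s0 < cabs z -> cabs z < 1 -> cabs (q z) <= B) ->
  forall w, cabs w < 1 -> P w != 0 -> cabs (q w) <= B.
Proof.
move=> B0 s1 DP P1 Dq bq qB w w1 Pw.
have Pw0 := cabs_gt0 Pw.
apply: (@expr_le_root _ _ _ (cabs (P w) ^- 2)) => // n.
rewrite mulrC ler_pdivlMr ?exprn_gt0// -!cabsX -cabsM.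
apply: (@maximum_principle (fun z => q z ^+ n * P z ^+ 2) _ s0) => //.
- exact: exprn_ge0.
- move=> z z1; have [Pz|Pz] := eqVneq (P z) 0; last first.
    by apply: cdiffM; apply: cdiffX; [exact: Dq|exact: DP].
  have [K [d [d0 hK]]] := bq z z1 Pz.
  have [l Dl] := DP z z1; have [d' d'0 hl] := cderiv_lip Dl.
  (* Near z the factor q^n is bounded and P^2 is quadratically small. *)
  exists 0; apply: (@cderiv_sqr0 _ _ _ (K ^+ n * (cabs l + 1) ^+ 2) (Num.min d d')).
    by rewrite lt_min d0.
  move=> v; rewrite lt_min => /andP[/hK h1 /hl]; rewrite Pz subr0 => h2.
  rewrite cabsM !cabsX -mulrA -exprMn; apply: ler_pM; rewrite ?exprn_ge0//.
    by apply: lerXn2r; rewrite ?nnegrE//; apply: le_trans h1.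
  by apply: lerXn2r; rewrite ?nnegrE//; apply: le_trans h2.
- move=> z z0 z1; rewrite cabsM !cabsX -[B ^+ n]mulr1.
  apply: ler_pM; rewrite ?exprn_ge0// ?exprn_ile1//; last exact: P1.
  by apply: lerXn2r; rewrite ?nnegrE//; exact: qB.
Qed.

(** f = O(w^m) at 0: a zero of order at least m, expressed without Taylor coefficients. *)
Definition vanish f m := exists (K : R) (d : R), 0 < d /\
  forall w, cabs w < d -> cabs (f w) <= K * cabs w ^+ m.

(** The maximum principle for f / z^m, which is bounded near 0 by assumption and by B / s^m for |z|
    > s. *)
Lemma vanish_bound f m B s : 0 <= B -> 0 < s < 1 ->
  (forall z, cabs z < 1 -> cdiff f z) ->
  (forall z, cabs z < 1 -> cabs (f z) <= B) -> vanish f m ->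
  forall w, cabs w < 1 -> w != 0 -> cabs (f w) <= B / s ^+ m * cabs w ^+ m.
Proof.
move=> B0 /andP[s0 s1] D fB [K [d [d0 hK]]] w w1 wn0.
rewrite -ler_pdivrMr ?exprn_gt0 ?cabs_gt0// -cabsX -cabsV -cabsM.
have sm : 0 < s ^+ m by exact: exprn_gt0.
apply: (@quotient_maximum_principle id (fun z => f z / z ^+ m) _ s) => //.
- by rewrite divr_ge0// ltW.
- by move=> z _; exact: cdiff_id.
- by move=> z /ltW.
- move=> z z1 zn0; apply: cdiffM; first exact: D.
  by apply: cdiffV; [rewrite expf_neq0|apply: cdiffX; exact: cdiff_id].
- move=> z _ ->; exists `|K|, d; split=> // v; rewrite subr0 => vd.
  (* At v = 0 the convention 0^-1 = 0 makes the quotient 0 when m > 0; for m = 0 it is f 0. *)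
  have [->|vn0] := eqVneq v 0.
    case: m hK {sm} => [|m] hK; last by rewrite expr0n /= invr0 mulr0 cabs0.
    rewrite expr0 divr1; have := hK 0; rewrite cabs0 expr0 mulr1 => /(_ d0) h.
    by apply: le_trans h _; exact: ler_norm.
  rewrite cabsM cabsV cabsX ler_pdivrMr ?exprn_gt0 ?cabs_gt0//.
  apply: le_trans (hK _ vd) _; apply: ler_wpM2r; first exact: exprn_ge0.
  exact: ler_norm.
- move=> z zs z1; rewrite cabsM cabsV cabsX; apply: ler_pM => //.
  + by rewrite invr_ge0 exprn_ge0.
  + exact: fB.
  + rewrite lef_pV2 ?posrE//; last by rewrite exprn_gt0// (lt_trans s0).
    by apply: lerXn2r; rewrite ?nnegrE// ltW.
Qed.

Lemma cdiff_vanish1 f : cdiff f 0 -> f 0 = 0 -> vanish f 1.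
Proof.
move=> [l Dl] f0; have [d d0 h] := cderiv_lip Dl.
exists (cabs l + 1), d; split=> // w wd.
by have := h w; rewrite f0 !subr0 expr1; apply.
Qed.

Lemma schwarz g : (forall z, cabs z < 1 -> cdiff g z) ->
  (forall z, cabs z < 1 -> cabs (g z) <= 1) -> g 0 = 0 ->
  forall w, cabs w < 1 -> cabs (g w) <= cabs w.
Proof.
move=> D g1 g0 w w1; have [->|wn0] := eqVneq w 0; first by rewrite g0.
have wp := cabs_gt0 wn0.
rewrite leNgt; apply/negP => gw.
have D0 : cdiff g 0 by apply: D; rewrite cabs0.
have gp : 0 < cabs (g w) by lra.
(* [vanish_bound] gives |g w| <= |w| / s for every s < 1; the midpoint of |w| / |g w| and 1
   contradicts this. *)
have [s [s0 hs]] : exists s : R, 0 < s < 1 /\ cabs w < s * cabs (g w).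
  have q1 : cabs w / cabs (g w) < 1 by rewrite ltr_pdivrMr// mul1r.
  have q0 : 0 < cabs w / cabs (g w) by rewrite divr_gt0.
  exists ((cabs w / cabs (g w) + 1) / 2); split; first by apply/andP; split; lra.
  by rewrite -ltr_pdivrMr//; lra.
have := vanish_bound ler01 s0 D g1 (cdiff_vanish1 D0 g0) w1 wn0.
rewrite !expr1 div1r mulrC ler_pdivlMr; last by case/andP: s0.
by lra.
Qed.

(** Schwarz's lemma for g composed with automorphisms that put a and g a at 0. *)
Lemma schwarz_pick g a w : (forall z, cabs z < 1 -> cdiff g z) ->
  (forall z, cabs z < 1 -> cabs (g z) < 1) -> cabs a < 1 -> cabs w < 1 ->
  cabs (mob (- g a) (g (mob a w))) <= cabs w.
Proof.
move=> D g1 a1 w1.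
have ga : cabs (- g a) < 1 by rewrite cabsN; exact: g1.
apply: (@schwarz (fun z => mob (- g a) (g (mob a z)))) => // [z z1|z z1|].
- apply: cdiff_comp; last by apply: cdiff_mob => //; apply: g1; exact: mob_disk.
  apply: cdiff_comp; first exact: cdiff_mob.
  by apply: D; exact: mob_disk.
- by apply/ltW/mob_disk => //; apply: g1; exact: mob_disk.
- by rewrite mob0 /mob subrr mul0r.
Qed.

(** The maximum principle for f / (z^m (z - v)): where |z| > 3 / 4, also |z - v| >= 1 / 4, which
    yields the constant. *)
Lemma vanish_bound_zero f m B v : 0 <= B -> v != 0 -> cabs v <= 1 / 2 ->
  (forall z, cabs z < 1 -> cdiff f z) ->
  (forall z, cabs z < 1 -> cabs (f z) <= B) -> vanish f m -> f 0 = 0 -> f v = 0 ->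
  forall w, cabs w < 1 ->
  cabs (f w) <= 4 * B / (3 / 4) ^+ m * (cabs w ^+ m * cabs (w - v)).
Proof.
move=> B0 vn0 v1 D fB [K [d [d0 hK]]] f0 fv w w1.
have vp := cabs_gt0 vn0.
have c0 : 0 <= 4 * B / (3 / 4) ^+ m.
  by rewrite divr_ge0 ?exprn_ge0//; lra.
have [->|wn0] := eqVneq w 0; first by rewrite f0 cabs0 !mulr_ge0 ?exprn_ge0.
have [->|wv] := eqVneq w v; first by rewrite fv cabs0 !mulr_ge0 ?exprn_ge0.
have cwv := cabs_subr_gt0 wv.
rewrite -ler_pdivrMr; last by rewrite mulr_gt0// exprn_gt0// cabs_gt0.
rewrite -cabsX -cabsM -cabsV -cabsM.
(* The factor 1 / 2 keeps the modulus of P at most 1. *)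
apply: (@quotient_maximum_principle (fun z => z * (z + - v) * (1 / 2)%:C)
  (fun z => f z / (z ^+ m * (z - v))) _ (3 / 4)) => //.
- by lra.
- move=> z _; apply: cdiffM; last exact: cdiff_cst.
  apply: cdiffM; first exact: cdiff_id.
  by apply: cdiffD; [exact: cdiff_id|exact: cdiff_cst].
- move=> z z1; rewrite !cabsM cabs_real ger0_norm; last by lra.
  have := cabsB z v; have := cabs_ge0 z; have := cabs_ge0 (z - v).
  by move=> *; nra.
- move=> z z1; rewrite !mulf_eq0 !negb_or -andbA => /and3P[z0 zv _].
  apply: cdiffM; first exact: D.
  apply: cdiffV; first by rewrite mulf_neq0// expf_neq0.
  apply: cdiffM; first by apply: cdiffX; exact: cdiff_id.
  by apply: cdiffD; [exact: cdiff_id|exact: cdiff_cst].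
- move=> z z1 /eqP; rewrite !mulf_eq0 -orbA => /or3P[/eqP ->|zv|]; last first.
  + by move=> /eqP[] h; exfalso; lra.
  + have -> : z = v by apply/eqP; rewrite -subr_eq0.
    have [l Dl] : cdiff f v by apply: D; lra.
    have [d' d'0 hl] := cderiv_lip Dl.
    (* Near v, f u / (u - v) is bounded by differentiability and |u| > |v| / 2. *)
    exists ((cabs l + 1) / (cabs v / 2) ^+ m), (Num.min d' (cabs v / 2)).
    split; first by rewrite lt_min d'0; lra.
    move=> u; rewrite lt_min => /andP[ud uv].
    have [->|un] := eqVneq u v.
      by rewrite subrr mulr0 invr0 mulr0 cabs0 divr_ge0 ?exprn_ge0 ?addr_ge0//; lra.
    have up := cabs_subr_gt0 un.
    have uu : cabs v / 2 < cabs u by have := cabs_sub v u; rewrite cabsC; lra.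
    have v2 : 0 < cabs v / 2 by lra.
    rewrite cabsM cabsV cabsM cabsX invfM mulrCA mulrC; apply: ler_pM => //.
    * by rewrite mulr_ge0// invr_ge0.
    * by rewrite invr_ge0 exprn_ge0.
    * by rewrite ler_pdivrMr//; have := hl u ud; rewrite fv subr0.
    * rewrite lef_pV2 ?posrE ?exprn_gt0//; last by lra.
      by apply: lerXn2r; rewrite ?nnegrE; lra.
  (* Near 0, f u / u^m is bounded by the order of vanishing and |u - v| > |v| / 2. *)
  + exists (`|K| / (cabs v / 2)), (Num.min d (cabs v / 2)).
    split; first by rewrite lt_min d0; lra.
    move=> u; rewrite subr0 lt_min => /andP[ud uv].
    have uu : cabs v / 2 < cabs (u - v) by have := cabs_sub v u; rewrite cabsC; lra.
    have v2 : 0 < cabs v / 2 by lra.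
    have [->|un] := eqVneq u 0.
      by rewrite f0 mul0r cabs0 divr_ge0// ltW.
    rewrite cabsM cabsV cabsM cabsX invfM mulrA; apply: ler_pM => //.
    * by rewrite mulr_ge0// invr_ge0 exprn_ge0.
    * by rewrite invr_ge0.
    * rewrite ler_pdivrMr ?exprn_gt0 ?cabs_gt0//; apply: le_trans (hK _ ud) _.
      by apply: ler_wpM2r; [exact: exprn_ge0|exact: ler_norm].
    * by rewrite lef_pV2 ?posrE ?ltW//; lra.
- move=> z zs z1.
  have zv : 1 / 4 <= cabs (z - v) by have := cabs_sub z v; lra.
  have zm : (3 / 4) ^+ m <= cabs z ^+ m.
    by apply: lerXn2r; rewrite ?nnegrE ?ltW//; lra.
  have p0 : 0 < (3 / 4 : R) ^+ m by apply: exprn_gt0; lra.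
  rewrite cabsM cabsV cabsM cabsX -mulrA mulrCA; apply: ler_pM => //.
  + by rewrite invr_ge0 mulr_ge0// exprn_ge0.
  + exact: fB.
  + rewrite (_ : 4 / _ = ((3 / 4) ^+ m * (1 / 4))^-1); last first.
      by field; rewrite gt_eqF.
    rewrite lef_pV2 ?posrE.
    * by apply: ler_pM.
    * by apply: mulr_gt0; [exact: lt_le_trans zm|lra].
    * by apply: mulr_gt0 => //; lra.
- rewrite !mulf_neq0 ?subr_eq0//; apply: cabs_neq0; rewrite cabs_real gtr0_norm; lra.
Qed.

End MaximumPrinciple.

(** * Bloch functions along an orbit *)

Section Bloch.
Variable R : realType.
Local Notation C := R[i].

(** Mean value inequality by bisection: an increment that is too large persists on one half at every
    scale, against differentiability at the limit point. *)
Lemma lipschitz_segment (F : C -> C) (w : C) (L : R) :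
  (forall t : R, 0 <= t <= 1 -> exists2 l, cderiv F (t%:C * w) l & cabs l <= L) ->
  cabs (F w - F 0) <= L * cabs w.
Proof.
move=> D; have w0 := cabs_ge0 w.
suff bound (e : R) : 0 < e -> cabs (F w - F 0) <= (L + e) * cabs w.
  apply/ler_addgt0Pr => e e0; have w1 : 0 < cabs w + 1 by lra.
  have e'0 : 0 < e / (cabs w + 1) by rewrite divr_gt0.
  apply: le_trans (bound _ e'0) _; rewrite mulrDl lerD2l mulrAC ler_pdivrMr//.
  by rewrite ler_pM2l//; lra.
move=> e0; rewrite leNgt; apply/negP => big.
pose J (t : R) := F (t%:C * w).
have JB s t : s%:C * w - t%:C * w = (s - t)%:C * w by rewrite rmorphB mulrBl.
(* The coordinate y is a dummy. *)
pose Bad (n : nat) (x y : R) := [/\ 0 <= x, x + 1 / 2 ^+ n <= 1 &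
  (L + e) * cabs w * (1 / 2 ^+ n) < cabs (J (x + 1 / 2 ^+ n) - J x)].
have [|n x y|p [py nest]] := @dyadic_nesting _ Bad 1 0 0 0 ler01 (lexx 0).
- rewrite /Bad expr0 divr1 add0r; split; rewrite ?lexx//.
  by rewrite mulr1 /J rmorph0 rmorph1 mul0r mul1r.
- rewrite /Bad; have : 0 <= 1 / 2 ^+ n.+1 :> R by rewrite divr_ge0// exprn_ge0.
  have -> : 1 / 2 ^+ n = 1 / 2 ^+ n.+1 + 1 / 2 ^+ n.+1 :> R.
    by rewrite exprS; field; rewrite expf_neq0// pnatr_eq0.
  rewrite !mul0r; move: (1 / 2 ^+ n.+1) ((L + e) * cabs w) => a c a0 [x0 x1].
  have := cabs_tri (J (x + a)) (J (x + (a + a))) (J x) => tri h.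
  have [k|k] := ltP (c * a) (cabs (J (x + a) - J x)).
    by exists x, y; split; try lra; split=> //; lra.
  exists (x + a), y; split; try lra; split; try lra.
  by rewrite -addrA; lra.
have [x0 [y0 [[x00 x01 _] /andP[px0 px1] _]]] := nest 0%N.
have [|l Dl lL] := D p; first by apply/andP; split; lra.
have [d d0 hd] := (cderiv_epsP _ _ _).1 Dl e e0.
have [n hn] := exp2_archi w0 d0.
have [x [y [[hx0 hx1 hbig] /andP[px px'] _]]] := nest n.
have c0 : 0 < 2 ^+ n :> R by exact: exprn_gt0.
have loc t : `|t - p| <= 1 / 2 ^+ n -> cabs (J t - J p) <= (L + e) * cabs w * `|t - p|.
  move=> tp; have := hd (t%:C * w); rewrite JB cabsM cabs_real.
  have -> : `|t - p| * cabs w < d.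
    by apply: le_lt_trans hn; rewrite mulrC ler_wpM2l// -div1r.
  move=> /(_ isT) h; rewrite /J.
  set A := F _ - F _ in h *; rewrite (_ : A = (A - l * ((t - p)%:C * w)) + l * ((t - p)%:C * w)).
    apply: le_trans (cabsD _ _) _; apply: le_trans (lerD h (lexx _)) _.
    rewrite !cabsM cabs_real.
    by have := ler_wpM2r (mulr_ge0 (normr_ge0 (t - p)) w0) lL; lra.
  by ring.
(* Since p lies between the endpoints, the bounds on its two sides add up to the whole length. *)
move: hbig (loc x) (loc (x + 1 / 2 ^+ n)) (cabs_tri (J p) (J (x + 1 / 2 ^+ n)) (J x)).
rewrite ler0_norm; last by lra.
rewrite ger0_norm; last by lra.
rewrite [cabs (J x - J p)]cabsC; move: px px'.
move: (1 / 2 ^+ n) ((L + e) * cabs w) => a c px px' b1 b2 b3 b4.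
have k2 : cabs (J p - J x) <= c * - (x - p) by apply: b2; lra.
have k3 : cabs (J (x + a) - J p) <= c * (x + a - p) by apply: b3; lra.
by lra.
Qed.

(** The derivative is a separate argument, so that the bound passes easily to f minus a constant. *)
Definition bloch_bound (f df : C -> C) (M : R) := forall z, cabs z < 1 ->
  cderiv f z (df z) /\ (1 - cabs z ^+ 2) * cabs (df z) <= M.

Lemma bloch_bound_ge0 f df M : bloch_bound f df M -> 0 <= M.
Proof.
move=> /(_ 0); rewrite cabs0 expr0n subr0 mul1r => -[]// _.
exact: le_trans (cabs_ge0 _).
Qed.

(** The Bloch seminorm is invariant under automorphisms, so the derivative of f o [mob a] is at most
    M / (1 - r^2) on |z| <= r, uniformly in a. *)
Lemma bloch_mob f df M (a w : C) (r : R) : bloch_bound f df M -> cabs a < 1 ->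
  cabs w <= r -> r < 1 ->
  cabs (f (mob a w) - f a) <= M / (1 - r ^+ 2) * cabs w.
Proof.
move=> bf a1 wr r1; have M0 := bloch_bound_ge0 bf.
rewrite -[in f a](mob0 a); apply: (@lipschitz_segment (fun z => f (mob a z))).
move=> t /andP[t0 t1]; set z := t%:C * w.
have zw : cabs z <= r.
  rewrite /z cabsM cabs_real ger0_norm//; apply: le_trans wr.
  by rewrite ler_piMl.
clearbody z; have z1 : cabs z < 1 by lra.
have m1 := mob_disk a1 z1; have [Df bz] := bf _ m1.
eexists; first exact: cderiv_comp (cderiv_mob a1 z1) Df.
have [h1 h2] := mob_den_gt0 a1 z1.
have a2 : 0 < 1 - cabs a ^+ 2 by rewrite subr_gt0 sqr_lt1.
have z2 : 0 < 1 - cabs z ^+ 2 by rewrite subr_gt0 sqr_lt1.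
have r2 : 0 < 1 - r ^+ 2 by rewrite subr_gt0 sqr_lt1//; apply: le_trans zw.
have d0 : cabs (1 + a^* * z) != 0 by rewrite gt_eqF//; lra.
have -> : cabs (df (mob a z) * ((1 - cabs a ^+ 2)%:C / (1 + a^* * z) ^+ 2)) =
    (1 - cabs (mob a z) ^+ 2) * cabs (df (mob a z)) / (1 - cabs z ^+ 2).
  rewrite cabs_mob// !cabsM cabs_real gtr0_norm// cabsV cabsX.
  by field; rewrite d0 gt_eqF.
apply: ler_pM => //.
- by rewrite mulr_ge0// subr_ge0 ltW// sqr_lt1.
- by rewrite invr_ge0 ltW.
- rewrite lef_pV2 ?posrE// lerD2l lerN2; apply: lerXn2r; rewrite ?nnegrE//.
  exact: le_trans zw.
Qed.

End Bloch.

(** * Eigenfunctions along an orbit of zero hyperbolic step *)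

Section Core.
Variable R : realType.
Local Notation C := R[i].
Variables (phi : C -> C) (tau z0 : C) (M : R).
Hypothesis Dphi : forall z, cabs z < 1 -> cdiff phi z.
Hypothesis phi1 : forall z, cabs z < 1 -> cabs (phi z) < 1.
Hypothesis tau1 : cabs tau = 1.
Hypothesis z01 : cabs z0 < 1.
Local Notation Z k := (iter k phi z0).
Local Notation W k := (mob (- Z k) (Z k.+1)).
Hypothesis W_cvg0 : forall e : R, 0 < e -> exists N, forall k, (N <= k)%N -> cabs (W k) < e.
Hypothesis Z_neq : forall k, Z k.+1 != Z k.

Lemma Z_disk k : cabs (Z k) < 1.
Proof. by elim: k => //= k; exact: phi1. Qed.
Hint Resolve Z_disk : core.

Lemma mobZ k : mob (Z k) (W k) = Z k.+1.
Proof. by rewrite mobNK. Qed.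

Lemma W_neq0 k : W k != 0.
Proof.
apply/eqP => h; have := mobZ k; rewrite h mob0 => /eqP.
by rewrite eq_sym (negbTE (Z_neq k)).
Qed.

(** Here f (Z k) = tau^k f z0, so all increments along the orbit have modulus |tau - 1| |f z0|,
    while [bloch_mob] bounds them by a multiple of |W k|. *)
Lemma orbit_value0 f df : bloch_bound f df M ->
  (forall z, cabs z < 1 -> f (phi z) = tau * f z) -> (tau - 1) * f z0 = 0.
Proof.
move=> bf feq; have M0 := bloch_bound_ge0 bf.
apply: cabs_eq0; apply/eqP; rewrite eq_le cabs_ge0 andbT.
apply/ler_addgt0Pr => e e0; rewrite add0r.
have fZ k : f (Z k) = tau ^+ k * f z0.
  by elim: k => [|k IH]; rewrite ?mul1r//= feq// IH exprS mulrA.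
pose c := M / (1 - (1 / 2) ^+ 2).
have c0 : 0 <= c by rewrite /c divr_ge0//; lra.
(* 1 / 2 is the radius for which c is the Lipschitz constant; c + 1 avoids a division by 0. *)
have e'0 : 0 < Num.min (1 / 2) (e / (c + 1)).
  by rewrite lt_min; apply/andP; split; [lra|rewrite divr_gt0//; lra].
have [N hN] := W_cvg0 e'0.
have := hN N (leqnn N); rewrite lt_min => /andP[w1].
rewrite ltr_pdivlMr => [w2|]; last by lra.
have h2 : 1 / 2 < 1 :> R by lra.
have := bloch_mob bf (Z_disk N) (ltW w1) h2; rewrite mobZ !fZ -/c.
have -> : tau ^+ N.+1 * f z0 - tau ^+ N * f z0 = tau ^+ N * ((tau - 1) * f z0).
  by rewrite exprS; ring.
rewrite [cabs (tau ^+ N * _)]cabsM cabsX tau1 expr1n mul1r => h.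
by have := cabs_ge0 (W N); lra.
Qed.

(** * Vanishing orders of an eigenfunction that is zero on the orbit *)

Variables (f df : C -> C).
Hypothesis bf : bloch_bound f df M.
Hypothesis feq : forall z, cabs z < 1 -> f (phi z) = tau * f z.
Hypothesis fz0 : f z0 = 0.

Local Notation F k := (fun w => f (mob (Z k) w)).

Lemma fZ0 k : f (Z k) = 0.
Proof. by elim: k => //= k IH; rewrite feq// IH mulr0. Qed.

Lemma cdiffF k w : cabs w < 1 -> cdiff (F k) w.
Proof.
move=> w1; apply: cdiff_comp; first exact: cdiff_mob.
by have [D _] := bf (mob_disk (Z_disk k) w1); exists (df (mob (Z k) w)).
Qed.

Lemma F_bound k w r : cabs w <= r -> r < 1 -> cabs (F k w) <= M / (1 - r ^+ 2).
Proof.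
move=> wr r1; have := bloch_mob bf (Z_disk k) wr r1; rewrite fZ0 subr0 => h.
apply: le_trans h _; apply: ler_piMr; last by lra.
rewrite divr_ge0 ?(bloch_bound_ge0 bf)// subr_ge0 ltW// sqr_lt1//.
exact: le_trans wr.
Qed.

(* By Schwarz-Pick the orbit transports values of f towards the base points. *)
Lemma F_transport K k w : (K <= k)%N -> cabs w < 1 ->
  exists2 w', cabs w' <= cabs w & cabs (F k w') = cabs (F K w).
Proof.
move=> /subnKC <- w1; elim: (k - K)%N => [|n [w' ww' IH]]; first by exists w; rewrite ?addn0.
rewrite addnS; set j := (K + n)%N in IH *.
have w'1 : cabs w' < 1 by apply: le_lt_trans w1.
exists (mob (- Z j.+1) (phi (mob (Z j) w'))).
  by apply: le_trans ww'; exact: (schwarz_pick Dphi phi1 (Z_disk j) w'1).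
have m1 := mob_disk (Z_disk j) w'1.
by rewrite (mobNK (Z_disk j.+1) (phi1 m1)) feq// cabsM tau1 mul1r.
Qed.

(** [F_bound] works on disks of radius r < 1, whereas the maximum principles need bounds on the unit
    disk; hence the rescaling by r. *)
Lemma cdiff_scale k (r : R) w : 0 <= r <= 1 -> cabs w < 1 ->
  cdiff (fun u => F k (r%:C * u)) w.
Proof.
move=> /andP[r0 r1] w1; apply: (@cdiff_comp _ (fun u => r%:C * u) (F k)).
  by apply: cdiffM; [exact: cdiff_cst|exact: cdiff_id].
apply: cdiffF; rewrite cabsM cabs_real ger0_norm//.
by apply: le_lt_trans w1; rewrite ler_piMl.
Qed.

Lemma vanish_scale g m (r : R) : 0 < r <= 1 -> vanish g m ->
  vanish (fun u : C => g (r%:C * u)) m.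
Proof.
move=> /andP[r0 r1] [K [d [d0 h]]]; exists (K * r ^+ m), d; split=> // w wd.
have rw : cabs (r%:C * w) = r * cabs w by rewrite cabsM cabs_real gtr0_norm.
have := h (r%:C * w); rewrite rw exprMn mulrA; apply.
by apply: le_lt_trans wd; rewrite ler_piMl.
Qed.

Lemma F_flat k : (forall m, vanish (F k) m) -> forall w, cabs w < 1 -> F k w = 0.
Proof.
move=> V w w1; have [->|wn0] := eqVneq w 0; first by rewrite mob0 fZ0.
have wp := cabs_gt0 wn0.
apply: contrapT => /eqP/cabs_gt0 Fw.
(* Choose |w| < r < 1, rescale w to u = w / r, and choose |u| < s < 1. *)
pose r := (1 + cabs w) / 2.
have r01 : 0 < r <= 1 by rewrite /r; apply/andP; split; lra.
have [r0 r1] := andP r01.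
have r1' : r < 1 by rewrite /r; lra.
have wr : cabs w < r by rewrite /r; lra.
pose u := w / r%:C.
have ru : r%:C * u = w.
  by rewrite mulrC divfK//; apply: cabs_neq0; rewrite cabs_real gtr0_norm.
have cu : cabs u = cabs w / r by rewrite cabsM cabsV cabs_real gtr0_norm.
have u1 : cabs u < 1 by rewrite cu ltr_pdivrMr// mul1r.
have up : 0 < cabs u by rewrite cu divr_gt0.
pose s := (1 + cabs u) / 2.
have s01 : 0 < s < 1 by rewrite /s; apply/andP; split; lra.
have us : cabs u < s by rewrite /s; lra.
have s0 : 0 < s by case/andP: s01.
pose B := M / (1 - r ^+ 2).
have B0 : 0 <= B.
  by rewrite divr_ge0 ?(bloch_bound_ge0 bf)// subr_ge0 ltW// sqr_lt1// ltW.
have key m : cabs (F k w) <= B * (cabs u / s) ^+ m.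
  have h : cabs (F k (r%:C * u)) <= B / s ^+ m * cabs u ^+ m.
    apply: (vanish_bound (f := fun u => F k (r%:C * u)) B0 s01 _ _ (vanish_scale r01 (V m))) => //.
    - by move=> z z1; apply: cdiff_scale => //; rewrite ltW.
    - move=> z z1; apply: F_bound => //; rewrite cabsM cabs_real gtr0_norm//.
      by rewrite ler_piMr// ltW.
    - exact: cabs_neq0.
  move: h; rewrite ru => h; rewrite expr_div_n.
  by rewrite (_ : B * _ = B / s ^+ m * cabs u ^+ m)//; ring.
(* Were F k w nonzero, [key] would bound all powers of |u| / s below by a positive constant,
   although |u| < s. *)
have : 1 <= cabs u / s.
  apply: (@expr_le_root _ _ _ (B / cabs (F k w))) => //.
    by rewrite divr_ge0// ltW.
  by move=> n; rewrite expr1n mulrAC ler_pdivlMr// mul1r.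
by rewrite ler_pdivlMr// mul1r; lra.
Qed.

(** [vanish_bound_zero] for u -> F k (u / 2), which is bounded on the disk and has its additional
    zero at 2 W k, of modulus at most 1 / 2. *)
Lemma F_extra_zero k m w : vanish (F k) m -> cabs (W k) <= 1 / 4 -> cabs w < 1 / 2 ->
  cabs (F k w) <= 4 * (M / (1 - (1 / 2) ^+ 2)) / (3 / 4) ^+ m *
    ((2 * cabs w) ^+ m * (2 * (cabs w + cabs (W k)))).
Proof.
move=> V W4 w2; set B := M / _.
have B0 : 0 <= B by rewrite divr_ge0 ?(bloch_bound_ge0 bf)//; lra.
have h01 : 0 < (1 / 2 : R) <= 1 by apply/andP; split; lra.
have hn x : cabs ((1 / 2)%:C * x) = cabs x / 2.
  by rewrite cabsM cabs_real ger0_norm; lra.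
have n2 (x : C) : cabs (2 * x) = 2 * cabs x.
  by rewrite cabsM (_ : 2 = (2 : R)%:C) ?cabs_real ?ger0_norm// rmorph_nat.
have hK (x : C) : (1 / 2)%:C * (2 * x) = x.
  rewrite (_ : 2 = (2 : R)%:C); last by rewrite rmorph_nat.
  by rewrite mulrA -rmorphM /= (_ : 1 / 2 * 2 = 1) ?mul1r//; field.
have := @vanish_bound_zero _ (fun u => F k ((1 / 2)%:C * u)) m B (2 * W k) B0.
rewrite !hK mulr0 mob0 fZ0 mobZ fZ0 n2.
move=> /(_ _ _ _ _ (vanish_scale h01 V) erefl erefl (2 * w)).
rewrite hK -mulrBr !n2 => h.
apply: le_trans (h _ _ _ _ _) _; last 1 first.
- apply: ler_wpM2l; first by rewrite divr_ge0 ?exprn_ge0//; lra.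
  apply: ler_wpM2l; first by rewrite exprn_ge0// mulr_ge0.
  by apply: ler_wpM2l => //; exact: cabsB.
- by rewrite mulf_neq0 ?W_neq0// pnatr_eq0.
- by lra.
- by move=> z z1; apply: cdiff_scale => //; apply/andP; split; lra.
- by move=> z z1; apply: F_bound; rewrite ?hn; lra.
- by lra.
Qed.

(* The vanishing order m at the orbit points being exact at some Z K, the values
   of F k near 0 stay large, whereas the additional zero W k -> 0 makes them small. *)
Lemma eigenfunction_zero w : cabs w < 1 -> f w = 0.
Proof.
move=> w1; apply: contrapT => fw.
(* Order 0 holds by boundedness. If no order were the last, [F_flat] at k = 0 would give f = 0. *)
have [m [Vm nVm]] : exists m, (forall k, vanish (F k) m) /\
    ~ (forall k, vanish (F k) m.+1).
  apply: contrapT => no.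
  have V m k : vanish (F k) m.
    elim: m k => [|m IH] k.
      exists (M / (1 - (1 / 2) ^+ 2)), (1 / 2); split; first by lra.
      by move=> u u1; rewrite expr0 mulr1; apply: F_bound; lra.
    by move: k; apply: contrapT => nV; apply: no; exists m.
  apply: fw; have := @F_flat 0%N (V^~ 0%N) (mob (- z0) w).
  by rewrite /= mobNK//; apply; apply: mob_disk => //; rewrite cabsN.
have [K nV] : exists K, ~ vanish (F K) m.+1 by apply/existsNP.
pose C0 := 4 * (M / (1 - (1 / 2) ^+ 2)) / (3 / 4) ^+ m.
have C00 : 0 <= C0.
  apply: divr_ge0; last by apply: exprn_ge0; lra.
  by apply: mulr_ge0 => //; apply: divr_ge0; [exact: bloch_bound_ge0 bf|lra].
(* Otherwise F K = O(w^(m+1)). The constant is what [F_extra_zero] yields when |w| and |W k| are at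
   most |v|. *)
have [v [v2 hv]] : exists v, cabs v < 1 / 2 /\
    C0 * 2 ^+ m * 4 * cabs v ^+ m.+1 < cabs (F K v).
  apply: contrapT => no; apply: nV; exists (C0 * 2 ^+ m * 4), (1 / 2).
  split; first by lra.
  by move=> v v2; rewrite leNgt; apply/negP => h; apply: no; exists v.
have vn0 : v != 0.
  apply: contraTneq hv => ->.
  by rewrite mob0 fZ0 cabs0 expr0n mulr0 ltxx.
have vp := cabs_gt0 vn0.
have e0 : 0 < Num.min (1 / 4) (cabs v) by rewrite lt_min vp andbT; lra.
have [N hN] := W_cvg0 e0.
(* Beyond N the zero W k is small; from K on the value F K v can be transported. *)
have := hN (maxn N K) (leq_maxl _ _); rewrite lt_min => /andP[W4 Wv].
have v1 : cabs v < 1 by lra.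
have [v' vv' Fv'] := F_transport (leq_maxr N K) v1.
have v'2 : cabs v' < 1 / 2 by lra.
have := F_extra_zero (Vm _) (ltW W4) v'2; rewrite Fv' -/C0 leNgt => /negP; apply.
apply: le_lt_trans hv; rewrite exprS exprMn.
rewrite (_ : _ * (cabs v * _) = C0 * (2 ^+ m * cabs v ^+ m * (4 * cabs v))); last by ring.
apply: ler_wpM2l => //; apply: ler_pM.
- by rewrite mulr_ge0 ?exprn_ge0.
- by rewrite mulr_ge0// addr_ge0.
- apply: ler_wpM2l; first exact: exprn_ge0.
  by apply: lerXn2r; rewrite ?nnegrE.
- by lra.
Qed.

End Core.

(** * Translation of the definitions and conclusion *)

Section Conversions.
Variable R : realType.
Local Notation C := R[i].

Lemma cvg_eps (u : nat -> C) (l : C) : (u @ \oo --> l)%classic ->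
  forall e : R, 0 < e -> exists N, forall k, (N <= k)%N -> cabs (u k - l) < e.
Proof.
move=> /cvgrPdist_lt h e e0.
have eC : 0 < e%:C by rewrite ltcR.
have [N _ hN] := h _ eC; exists N => k /hN /=.
by rewrite normc_cabs ltcR cabsC.
Qed.

(** The two denominators are complex conjugates of each other. *)
Lemma pseudo_hyp_mob (z w : C) : pseudo_hyp z w = (cabs (mob (- z) w))%:C.
Proof.
rewrite /pseudo_hyp normc_cabs /mob conjcN; congr (_%:C).
rewrite !cabsM !cabsV; congr (_ / _); rewrite -cabs_conj; congr cabs.
by case: z w => [a b] [c d]; simpc; congr (_ +i* _); ring.
Qed.

Lemma bloch_bloch_bound (f : C -> C) : bloch f ->
  exists M, bloch_bound f ('D_1 f) M.
Proof.
move=> [hf [M hM]]; exists M => z /in_diskE zD; split.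
  by apply: derivable_cderiv; exact: hf.
have := hM z zD; rewrite !normc_cabs -rmorphXn -[1]/(1%:C) -rmorphB -rmorphM /=.
by rewrite lecR.
Qed.

End Conversions.

Theorem theorem5p3 (R : realType) (phi : R[i] -> R[i]) :
  holomorphic_self_map phi -> parabolic phi -> zero_hyperbolic_step phi ->
  ~ (exists (f : R[i] -> R[i]) (tau : R[i]),
       bloch f /\ nonconstant_on_disk f /\ `|tau| = 1 /\
       (forall z, in_disk z -> f (phi z) = tau * f z)).
Proof.
move=> [hphi phiD] [om [om1 [dw _]]] [z0 [z0D zstep]].
move=> [f [tau [/bloch_bloch_bound[M bf] [[a [b [aD [bD fab]]]] [tau1 feq]]]]].
have Dphi z : cabs z < 1 -> cdiff phi z.
  by move=> /in_diskE/hphi/derivable_cderiv h; eexists; exact: h.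
have phi1 z : cabs z < 1 -> cabs (phi z) < 1.
  by move=> /in_diskE/phiD/in_diskE.
have z01 : cabs z0 < 1 by apply/in_diskE.
have ctau : cabs tau = 1 by move: tau1; rewrite normc_cabs => -[].
have com : cabs om = 1 by move: om1; rewrite normc_cabs => -[].
have W0 (e : R) : 0 < e -> exists N, forall k, (N <= k)%N ->
    cabs (mob (- iter k phi z0) (iter k.+1 phi z0)) < e.
  move=> /(cvg_eps zstep)[N hN]; exists N => k /hN.
  by rewrite subr0 pseudo_hyp_mob cabs_real ger0_norm.
(* An orbit stationary from k on would stay at an interior point and could not converge to the
   boundary point om. *)
have Zn k : iter k.+1 phi z0 != iter k phi z0.
  apply/eqP => fixk.
  have Zk : cabs (iter k phi z0) < 1.
    by elim: (k) => //= j; exact: phi1.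
  have cst n : iter (n + k) phi z0 = iter k phi z0.
    by elim: n => // n IH; rewrite addSn iterS IH -iterS.
  have d0 : 0 < 1 - cabs (iter k phi z0) by lra.
  have [N /(_ (N + k)%N (leq_addr _ _))] := cvg_eps (dw z0 z0D) d0.
  rewrite cst cabsC; have := cabs_sub om (iter k phi z0).
  by rewrite com; lra.
have feq' z : cabs z < 1 -> f (phi z) = tau * f z by move=> /in_diskE; exact: feq.
have fz := orbit_value0 phi1 ctau z01 W0 bf feq'.
have bg : bloch_bound (fun z => f z + - f z0) (fun z => ('D_1 f z + 0)%R) M.
  move=> z /bf[Df bz]; split; last by rewrite addr0.
  by apply: cderivD => //; exact: cderiv_cst.
have g0 z : cabs z < 1 -> f z = f z0.
  move=> z1; apply/eqP; rewrite -subr_eq0; apply/eqP.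
  apply: (eigenfunction_zero Dphi phi1 ctau z01 W0 Zn bg) => //; last by rewrite subrr.
  move=> v v1; rewrite feq' //.
  (* The functional equation survives the subtraction of f z0 because (tau - 1) f z0 = 0. *)
  have -> : tau * f v - f z0 = tau * (f v - f z0) + (tau - 1) * f z0 by ring.
  by rewrite fz addr0.
by apply: fab; rewrite !g0//; apply/in_diskE.
Qed.
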